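(* Let $P_m=P_m(\cdot;\underline t;q)$ ($m\in\mathbb Z$), $P_m^+=P_m^+(\cdot;a,b,c,d)$ ($m\in\mathbb Z_+$) and $P_m^-$ ($m\in\mathbb N$) be the monic non-symmetric, symmetric and anti-symmetric Askey-Wilson polynomials. (i) For $m\in\mathbb Z_+$, $$P_m(x)=q^m\frac{1-abcdq^{m-1}}{1-abcdq^{2m-1}}P_m^+(x;a,b,c,d)+q^{(m-1)/2}\frac{(1-cx^{-1})(1-dx^{-1})x(1-q^m)}{1-abcdq^{2m-1}}P_{m-1}^+(q^{-1/2}x;q^{1/2}a,q^{1/2}b,q^{1/2}c,q^{1/2}d),$$ where the second term is read as zero when $m=0$. (ii) For $m\in\mathbb N$, $$P_{-m}(x)=\frac{1}{1-cdq^{m-1}}P_m^+(x;a,b,c,d)-q^{(m-1)/2}\frac{(1-cx^{-1})(1-dx^{-1})x}{1-cdq^{m-1}}P_{m-1}^+(q^{-1/2}x;q^{1/2}a,q^{1/2}b,q^{1/2}c,q^{1/2}d).$$ (iii) For $m\in\mathbb N$, $$P_m^-(x)=\frac{1-abcdq^{m-1}}{ab(1-cdq^{m-1})}P_m^+(x;a,b,c,d)+q^{(m-1)/2}\frac{(1-cx^{-1})(1-dx^{-1})x(ab-1)}{ab(1-cdq^{m-1})}P_{m-1}^+(q^{-1/2}x;q^{1/2}a,q^{1/2}b,q^{1/2}c,q^{1/2}d).$$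
   Context: $\mathbb Z_+=\{0,1,2,\dots\}$, $\mathbb N=\{1,2,\dots\}$. Parameters: $q\in\mathbb C\setminus\{0\}$ with $|q|\ne1$ and a fixed square root $q^{1/2}$; $\underline t=(k_0,k_1,u_0,u_1)$ nonzero complex numbers with $k_0^2,k_1^2,u_1^2\notin\{\pm q^j:j\in\mathbb Z\}$. Set $a=k_1u_1$, $b=-k_1u_1^{-1}$, $c=q^{1/2}k_0u_0$, $d=-q^{1/2}k_0u_0^{-1}$. $\mathcal A=\mathbb C[x^{\pm1}]$. Define linear operators on $\mathcal A$ by $(T_1f)(x)=k_1f(x)+k_1^{-1}\frac{(1-ax)(1-bx)}{1-x^2}\bigl(f(x^{-1})-f(x)\bigr)$ and $(T_0f)(x)=k_0f(x)+k_0^{-1}\frac{(1-cx^{-1})(1-dx^{-1})}{1-qx^{-2}}\bigl(f(qx^{-1})-f(x)\bigr)$, and put $Y=T_1T_0$. Let $\epsilon(m)=1$ for $m\ge0$, $\epsilon(m)=-1$ for $m<0$, and $\gamma_m=(k_0k_1)^{\epsilon(m)}q^m$ ($m\in\mathbb Z$). Order the monomials by $1\prec x^{-1}\prec x\prec x^{-2}\prec x^2\prec\cdots$. $P_m$ ($m\in\mathbb Z$) is the unique Laurent polynomial of the form $x^m+$ lower order terms w.r.t. $\preceq$ with $YP_m=\gamma_mP_m$. $P_m^+$ ($m\in\mathbb Z_+$) is the unique element of $\mathrm{span}\{P_m,P_{-m}\}$ of the form $x^m+$ lower order terms with $T_1P_m^+=k_1P_m^+$ (equivalently, $P_m^+(x)=P_m^+(x^{-1})$).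 $P_m^-$ ($m\in\mathbb N$) is the unique element of $\mathrm{span}\{P_m,P_{-m}\}$ of the form $x^m+$ lower order terms with $T_1P_m^-=-k_1^{-1}P_m^-$. $P_m^+(\cdot;a,b,c,d)$ denotes $P_m^+$ with its parameter dependence displayed; $P_{m-1}^+(\cdot;q^{1/2}a,q^{1/2}b,q^{1/2}c,q^{1/2}d)$ is the symmetric polynomial built from the parameters $(q^{1/2}k_0,q^{1/2}k_1,u_0,u_1)$ and the same $q$. *)

(* Defs.v *)
From HB Require Import structures.
From mathcomp Require Import all_boot all_order all_algebra.
From mathcomp Require Import boolp classical_sets reals complex.

Set Implicit Arguments.
Unset Strict Implicit.
Unset Printing Implicit Defensive.

Import Order.TTheory GRing.Theory Num.Theory.
Local Open Scope ring_scope.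

(* Laurent polynomials in x over the complex numbers R[i] are handled inside
   the field C(x) of rational functions, so that the operators T_0 and T_1 can
   be written with their denominators 1 - x^2 and 1 - q x^-2.  Both operators
   preserve C[x^{+-1}]. *)

Section RationalFunctions.
Variable R : realType.
Local Notation C := (complex R).
Local Notation Cx := {fraction {poly (complex R)}}.

Definition cst (z : C) : Cx := tofrac (z%:P).

Definition xx : Cx := tofrac 'X.

(* f(g(x)), computed on a fraction n/d representing f.  It does not depend on
   the representative when g is not constant; g is always a nonzero multiple
   of x or x^-1 below. *)
Definition subst (f g : Cx) : Cx :=
  (map_poly cst \n_(repr f)).[g] / (map_poly cst \d_(repr f)).[g].

(* 1 < x^-1 < x < x^-2 < x^2 < ..., on exponents *)
Definition mon_lt (n m : int) : bool :=
  (`|n| < `|m|)%N || ((`|n| == `|m|)%N && (n < m)).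

Definition monic_at (m : int) (f : Cx) : Prop :=
  exists (r : seq int) (e : int -> C),
    f = xx ^ m + \sum_(n <- r | mon_lt n m) cst (e n) * xx ^ n.

End RationalFunctions.

Section AskeyWilson.
Variable R : realType.
Local Notation C := (complex R).
Local Notation Cx := {fraction {poly (complex R)}}.
Local Notation x := (xx R).

(* s is the fixed square root q^{1/2} *)
Variables (q s k0 k1 u0 u1 : C).

Definition AWa : C := k1 * u1.
Definition AWb : C := - (k1 * u1^-1).
Definition AWc : C := s * k0 * u0.
Definition AWd : C := - (s * k0 * u0^-1).

Definition T1 (f : Cx) : Cx :=
  cst k1 * f
  + cst k1^-1 * ((1 - cst AWa * x) * (1 - cst AWb * x) / (1 - x ^+ 2))
    * (subst f x^-1 - f).

Definition T0 (f : Cx) : Cx :=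
  cst k0 * f
  + cst k0^-1 * ((1 - cst AWc * x^-1) * (1 - cst AWd * x^-1)
                  / (1 - cst q * x ^- 2))
    * (subst f (cst q * x^-1) - f).

Definition AWY (f : Cx) : Cx := T1 (T0 f).

Definition eps (m : int) : int := if 0 <= m then 1 else -1.

Definition gamma (m : int) : C := (k0 * k1) ^ eps m * q ^ m.

Definition is_nonsymAW (m : int) (f : Cx) : Prop :=
  monic_at m f /\ AWY f = cst (gamma m) * f.

(* P_m: xget picks the element satisfying the characterization, which is
   unique when the eigenvalues gamma are pairwise distinct. *)
Definition nonsymAW (m : int) : Cx := xget 0 [set f | is_nonsymAW m f]%classic.

Definition in_span_pm (m : nat) (f : Cx) : Prop :=
  exists e1 e2 : C,
    f = cst e1 * nonsymAW m%:Z + cst e2 * nonsymAW (- m%:Z).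

Definition is_symAW (m : nat) (f : Cx) : Prop :=
  [/\ in_span_pm m f, monic_at m%:Z f & T1 f = cst k1 * f].

(* P_m^+ *)
Definition symAW (m : nat) : Cx := xget 0 [set f | is_symAW m f]%classic.

Definition is_antisymAW (m : nat) (f : Cx) : Prop :=
  [/\ in_span_pm m f, monic_at m%:Z f & T1 f = cst (- k1^-1) * f].

(* P_m^-, meaningful for m > 0 *)
Definition antisymAW (m : nat) : Cx :=
  xget 0 [set f | is_antisymAW m f]%classic.

End AskeyWilson.

Definition not_pm_qpow (R : realType) (q z : complex R) : Prop :=
  forall j : int, z != q ^ j /\ z != - q ^ j.

(* Main.v *)
Require Import Defs.
From HB Require Import structures.
From mathcomp Require Import all_boot all_order all_algebra.
From mathcomp Require Import boolp classical_sets reals complex.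
From mathcomp Require Import generic_quotient ring zify.
Set Implicit Arguments.
Unset Strict Implicit.
Unset Printing Implicit Defensive.
Import Order.TTheory GRing.Theory Num.Theory.
Local Open Scope ring_scope.

(** The operator [Z = Y + Y^-1] has the eigenvalue [gamma_m + gamma_m^-1] on the
    span of [P_m] and [P_(-m)].  On that plane [T1] and [T0] are explicit
    2x2 matrices: putting [P_m^+ = k1^-1 (T1 + k1^-1) P_(-m)], the equation
    [Y P_(-m) = gamma_m^-1 P_(-m)] becomes
    [T0 P_(-m) = gamma_m^-1 k1 (P_m^+ - P_(-m))], and both [P_m] and [P_m^-] are
    explicit combinations of [P_m^+] and [P_(-m)].  Now [(T0 - k0) P_(-m)] lies in
    the [-k0^-1]-eigenspace of [T0], so it equals [w H] up to a constant, with
    [w = (1 - c/x) (1 - d/x) x] and [H] the divided difference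
    [q^m (P_(-m)(q/x) - P_(-m)(x)) / (x - q/x)].  Conjugating [Z] by [w] and by
    [x -> q^(1/2) x] gives the operator [Z] of the parameters
    [(q^(1/2) k0, q^(1/2) k1, u0, u1)] on symmetric functions, whence
    [H(q^(1/2) x)] is [q^((m-1)/2)] times the shifted [P_(m-1)^+].  Existence and
    uniqueness of all the eigenfunctions come from the triangularity of [Y] on
    the ordered monomials. *)

(** * Rational functions, constants and substitution *)

Lemma frac_repr (D : idomainType) (f : {fraction D}) :
  f = tofrac \n_(repr f) / tofrac \d_(repr f).
Proof.
apply: (canRL (mulfK _)); first by rewrite tofrac_eq0 denom_ratioP.
rewrite -[f in LHS]reprK; unlock tofrac; rewrite -[LHS]FracField.pi_mul.
apply/eqmodP; rewrite /= FracField.equivfE /FracField.mulf /=.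
have n0 := oner_neq0 D; rewrite !numden_Ratio ?mulf_neq0 ?denom_ratioP //.
by rewrite !mulr1 reprK mulrC.
Qed.

Section RationalFunctions.
Variable R : realType.
Local Notation C := (complex R).
Local Notation Cx := {fraction {poly (complex R)}}.
Local Notation x := (xx R).
Implicit Types (f g h : Cx) (z e : C).

Fact cst_is_zmod_morphism : zmod_morphism (@cst R).
Proof. by move=> z e; rewrite /cst polyCB rmorphB. Qed.

Fact cst_is_monoid_morphism : monoid_morphism (@cst R).
Proof. by split=> [|z e]; rewrite /cst ?polyC1 ?rmorph1 // polyCM rmorphM. Qed.

HB.instance Definition _ :=
  GRing.isZmodMorphism.Build C Cx (@cst R) cst_is_zmod_morphism.
HB.instance Definition _ :=
  GRing.isMonoidMorphism.Build C Cx (@cst R) cst_is_monoid_morphism.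

(* A one-constructor type rather than a definition: otherwise [done] unfolds it
   and tries to evaluate the equality test of the fraction field. *)
Variant nonconst g : Prop := Nonconst of forall z, g != cst z.

Lemma nonconstP g z : nonconst g -> g != cst z.
Proof. by case=> gnc; apply: gnc. Qed.

Definition peval (p : {poly C}) g : Cx := (map_poly (@cst R) p).[g].

Lemma pevalB g : {morph peval^~ g : p r / p - r}.
Proof. by move=> p r; rewrite /peval rmorphB !hornerE. Qed.

Lemma pevalM g : {morph peval^~ g : p r / p * r}.
Proof. by move=> p r; rewrite /peval rmorphM !hornerE. Qed.

Lemma peval1 g : peval 1 g = 1.
Proof. by rewrite /peval rmorph1 hornerE. Qed.

Lemma pevalC z g : peval z%:P g = cst z.
Proof. by rewrite /peval map_polyC hornerE. Qed.

Lemma pevalX g : peval 'X g = g.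
Proof. by rewrite /peval map_polyX hornerE. Qed.

(** Over the algebraically closed field C, [p] splits into factors X - z, and no [g - z] vanishes
    for a nonconstant [g]. This keeps the denominators of substitutions nonzero. *)
Lemma peval_neq0 p g : nonconst g -> p != 0 -> peval p g != 0.
Proof.
move=> gnc p0; have [r ->] := closed_field_poly_normal p.
rewrite -mul_polyC pevalM pevalC mulf_neq0 ?fmorph_eq0 ?lead_coef_eq0 //.
elim: r => [|z r IH]; first by rewrite big_nil peval1 oner_neq0.
rewrite big_cons pevalM; apply: mulf_neq0; last exact: IH.
by rewrite pevalB pevalX pevalC subr_eq0; apply: nonconstP.
Qed.

(** Two fractions of the same function cross-multiply to equal polynomials, and evaluation is
    multiplicative, so the representative chosen by [repr] does not matter. *)
Lemma subst_ratio n d g : nonconst g -> d != 0 ->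
  subst (tofrac n / tofrac d) g = peval n g / peval d g.
Proof.
move=> gnc d0; rewrite /subst -/(peval _ _) -/(peval _ _).
set f := tofrac n / tofrac d.
have e0 := denom_ratioP (repr f).
apply/eqP; rewrite eqr_div ?peval_neq0 // -!pevalM; apply/eqP.
congr (peval _ _); apply/eqP; rewrite -tofrac_eq !rmorphM /=.
by rewrite -eqr_div ?tofrac_eq0 // -frac_repr.
Qed.

Variable (g : Cx).
Hypothesis gnc : nonconst g.

Lemma subst_poly p : subst (tofrac p) g = peval p g.
Proof.
have -> : tofrac p = tofrac p / tofrac 1 by rewrite rmorph1 divr1.
by rewrite subst_ratio ?oner_eq0 // peval1 divr1.
Qed.

Lemma subst_cst z : subst (cst z) g = cst z.
Proof. by rewrite subst_poly pevalC. Qed.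

Lemma subst_xx : subst x g = g.
Proof. by rewrite subst_poly pevalX. Qed.

(* [subst] takes the function first; this repackages it as a ring morphism. *)
Definition substm & nonconst g := (@subst R)^~ g.

Fact subst_is_zmod_morphism : zmod_morphism (substm gnc).
Proof.
move=> f h; rewrite /substm (frac_repr f) (frac_repr h).
have := denom_ratioP (repr f); have := denom_ratioP (repr h).
move: \n_(repr f) \n_(repr h) \d_(repr f) \d_(repr h) => n m d e e0 d0.
rewrite -mulNr -rmorphN addf_div ?tofrac_eq0 // -!rmorphM -rmorphD /=.
rewrite !subst_ratio ?mulf_neq0 // -mulNr addf_div ?peval_neq0 //.
by rewrite !mulNr -!pevalM -pevalB.
Qed.

Fact subst_is_monoid_morphism : monoid_morphism (substm gnc).
Proof.
rewrite /substm; split=> [|f h]; first by rewrite -(rmorph1 (@cst R)) subst_cst.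
rewrite (frac_repr f) (frac_repr h).
have := denom_ratioP (repr f); have := denom_ratioP (repr h).
move: \n_(repr f) \n_(repr h) \d_(repr f) \d_(repr h) => n m d e e0 d0.
rewrite mulf_div -!rmorphM /= !subst_ratio ?mulf_neq0 // !pevalM.
by rewrite mulf_div.
Qed.

HB.instance Definition _ :=
  GRing.isZmodMorphism.Build Cx Cx (substm gnc) subst_is_zmod_morphism.
HB.instance Definition _ :=
  GRing.isMonoidMorphism.Build Cx Cx (substm gnc) subst_is_monoid_morphism.

Lemma substD : {morph (@subst R)^~ g : f h / f + h}.
Proof. exact: (rmorphD (substm gnc)). Qed.
Lemma substN : {morph (@subst R)^~ g : f / - f}.
Proof. exact: (rmorphN (substm gnc)). Qed.
Lemma substM : {morph (@subst R)^~ g : f h / f * h}.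
Proof. exact: (rmorphM (substm gnc)). Qed.
Lemma substV : {morph (@subst R)^~ g : f / f^-1}.
Proof. exact: (fmorphV (substm gnc)). Qed.
Lemma subst0 : subst 0 g = 0.
Proof. exact: (rmorph0 (substm gnc)). Qed.
Lemma subst1 : subst 1 g = 1.
Proof. exact: (rmorph1 (substm gnc)). Qed.
Lemma substXz (n : int) : {morph (@subst R)^~ g : f / f ^ n}.
Proof. by move=> f; exact: (fmorphXz (substm gnc)). Qed.

Lemma subst_nonconst f : nonconst f -> nonconst (subst f g).
Proof.
move=> fnc; split=> z; apply: contra_neq (nonconstP z fnc) => fz.
by apply: (fmorph_inj (substm gnc)); rewrite /= /substm fz subst_cst.
Qed.

Lemma subst_comp f h : nonconst h -> subst (subst f h) g = subst f (subst h g).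
Proof.
move=> hnc; rewrite (frac_repr f).
have d0 := denom_ratioP (repr f).
rewrite !subst_ratio //; last exact: subst_nonconst.
have pe p : subst (peval p h) g = peval p (subst h g).
  rewrite -[LHS]/(substm gnc (peval p h)) /peval -horner_map -map_poly_comp.
  by congr _.[_]; apply: eq_map_poly => z; rewrite /= /substm subst_cst.
by rewrite substM substV !pe.
Qed.

End RationalFunctions.

Section Nonconst.
Variable R : realType.
Local Notation x := (xx R).

Lemma xx_nonconst : nonconst x.
Proof.
split=> z; rewrite tofrac_eq; apply/eqP => /(congr1 (size \o polyseq)) /=.
by rewrite size_polyX size_polyC; case: (z != 0).
Qed.

Lemma xx_neq0 : x != 0.
Proof. by have := nonconstP 0 xx_nonconst; rewrite rmorph0. Qed.

Lemma subst_id (f : {fraction {poly (complex R)}}) : subst f x = f.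
Proof.
have pe p : peval p x = tofrac p.
  rewrite /peval (_ : map_poly _ p = map_poly (@tofrac _) (map_poly polyC p)).
    by rewrite horner_map -/(_ \Po _) comp_polyXr.
  by rewrite -map_poly_comp.
rewrite [in LHS](frac_repr f) subst_ratio ?pe -?frac_repr ?denom_ratioP //.
exact: xx_nonconst.
Qed.

Lemma cstM_nonconst (z : complex R) f : z != 0 -> nonconst f -> nonconst (cst z * f).
Proof.
move=> z0 fnc; split=> e; apply: contra_neq (nonconstP (z^-1 * e) fnc) => ze.
by rewrite rmorphM /= -ze fmorphV mulKf ?fmorph_eq0.
Qed.

Lemma nonconstV (f : {fraction {poly (complex R)}}) :
  nonconst f -> nonconst f^-1.
Proof.
move=> fnc; split=> z; apply: contra_neq (nonconstP z^-1 fnc) => fz.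
by rewrite fmorphV /= -fz invrK.
Qed.

(** Constants have their square roots in C, so a constant square would force [f] to be constant.
    This yields the nonvanishing of 1 - x^2 and x^2 - q. *)
Lemma nonconstX2 (f : {fraction {poly (complex R)}}) :
  nonconst f -> nonconst (f ^+ 2).
Proof.
move=> fnc; split=> z; apply/eqP; rewrite -[z]sqrtCK rmorphXn => /eqP.
rewrite eqf_sqr -rmorphN => /orP[] /eqP fz.
  by have /eqP := nonconstP (sqrtC z) fnc.
by have /eqP := nonconstP (- sqrtC z) fnc.
Qed.

End Nonconst.

(** * Spans of monomials *)

Section LaurentSpan.
Variable R : realType.
Local Notation C := (complex R).
Local Notation Cx := {fraction {poly (complex R)}}.
Local Notation x := (xx R).
Implicit Types (f g h : Cx) (c e : C) (p : pred int) (n m : int).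

(** Combinations are built one term at a time, exponents possibly repeated, so that linear
    statements follow by induction. *)
Inductive lspan p : Cx -> Prop :=
| lspan0 : lspan p 0
| lspan_cons c n f : p n -> lspan p f -> lspan p (cst c * x ^ n + f).

Lemma lspanD p f g : lspan p f -> lspan p g -> lspan p (f + g).
Proof.
move=> pf pg; elim: pf => [|c n h pn _ IH]; first by rewrite add0r.
by rewrite -addrA; apply: lspan_cons.
Qed.

Lemma lspanZ p c f : lspan p f -> lspan p (cst c * f).
Proof.
elim=> [|e n h pn _ IH]; first by rewrite mulr0; apply: lspan0.
by rewrite mulrDr mulrA -rmorphM; apply: lspan_cons.
Qed.

Lemma lspanN p f : lspan p f -> lspan p (- f).
Proof. by move/(lspanZ (-1)); rewrite rmorphN1 mulN1r. Qed.

Lemma lspanB p f g : lspan p f -> lspan p g -> lspan p (f - g).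
Proof. by move=> pf pg; apply: lspanD => //; apply: lspanN. Qed.

Lemma lspanX p n : p n -> lspan p (x ^ n).
Proof.
by move=> pn; have := lspan_cons 1 pn (lspan0 p); rewrite rmorph1 mul1r addr0.
Qed.

Lemma lspan_sum (I : Type) p (r : seq I) (P : pred I) (F : I -> Cx) :
  (forall i, P i -> lspan p (F i)) -> lspan p (\sum_(i <- r | P i) F i).
Proof. by apply: big_ind => [|f g]; [exact: lspan0|exact: lspanD]. Qed.

Lemma sub_lspan p p' f : (forall n, p n -> p' n) -> lspan p f -> lspan p' f.
Proof.
move=> pp'; elim=> [|c n h pn _ IH]; first exact: lspan0.
by apply: lspan_cons => //; apply: pp'.
Qed.

Lemma lspan_poly p f : lspan p f -> exists (N : nat) (P : {poly C}),
  f * x ^+ N = tofrac P /\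
  forall (m : int) (M : nat), ~~ p m -> M%:Z = m + N%:Z -> P`_M = 0.
Proof.
elim=> [|c n h pn _ [N [P [hP P0]]]].
  by exists 0%N, 0; split=> [|m M _ _]; rewrite ?mul0r ?rmorph0 ?coef0.
exists (N + `|n|)%N, (c%:P * 'X^(absz (n + N%:Z + (absz n)%:Z)) + P * 'X^`|n|).
split=> [|m M pm Mm].
  rewrite rmorphD !rmorphM !rmorphXn /= -/(cst c) -/x -hP exprD mulrDl.
  rewrite [h * _]mulrA -mulrA; congr (_ * _ + _).
  by rewrite -exprD !exprnP -expfzDr ?xx_neq0 //; congr (_ ^ _); lia.
rewrite coefD coefCM coefXn coefMXn.
have -> : (M == absz (n + N%:Z + (absz n)%:Z)) = false.
  by apply: contraNF pm => /eqP eM; have -> : m = n by lia.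
rewrite mulr0 add0r; case: ltnP => // nM; apply: P0 pm _.
by lia.
Qed.

Lemma lspan_free p c m : ~~ p m -> lspan p (cst c * x ^ m) -> c = 0.
Proof.
move=> pm /lspan_poly[N [P [hP P0]]].
(* The extra factor x^|m| keeps the exponent of x^m nonnegative, since N alone may be smaller than
   -m. *)
have /eqP : cst c * x ^ m * x ^+ N * x ^+ `|m| = tofrac (P * 'X^`|m|).
  by rewrite hP rmorphM rmorphXn.
have -> : cst c * x ^ m * x ^+ N * x ^+ `|m|
    = tofrac (c%:P * 'X^(absz (m + N%:Z + (absz m)%:Z))).
  rewrite rmorphM rmorphXn /= -/(cst c) -/x -!mulrA; congr (_ * _).
  by rewrite !exprnP -!expfzDr ?xx_neq0 //; congr (_ ^ _); lia.
set K := absz _; rewrite tofrac_eq => /eqP/(congr1 (fun r : {poly C} => r`_K)).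
rewrite coefCM coefXn eqxx mulr1 coefMXn => ->; case: ltnP => // mM.
by apply: P0 pm _; lia.
Qed.

Lemma monic_atP m f : monic_at m f <-> lspan (mon_lt^~ m) (f - x ^ m).
Proof.
split=> [[r [e ->]]|].
  rewrite addrAC subrr add0r; apply: lspan_sum => n nm.
  by apply/lspanZ/lspanX.
set p := mon_lt^~ m => pf.
suff [r [e [_ fE]]] : exists (r : seq int) (e : int -> C),
    uniq r /\ f - x ^ m = \sum_(n <- r | p n) cst (e n) * x ^ n.
  by exists r, e; rewrite -fE addrC subrK.
elim: pf => [|c n h pn _ [r [e [ur ->]]]].
  by exists [::], (fun=> 0); rewrite big_nil.
(* A repeated exponent is merged: [e] is read as 0 outside [r], and [c] is added at [n]. *)
exists (if n \in r then r else n :: r).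
exists (fun i => (if i \in r then e i else 0) + (if i == n then c else 0)).
case: ifPn => nr; split=> //=; last 2 first.
- by rewrite nr.
- rewrite big_cons pn (negPf nr) eqxx add0r; congr (_ + _).
  rewrite big_seq_cond [RHS]big_seq_cond; apply: eq_bigr => i /andP[ir _].
  rewrite ir; case: eqP => [iN|_]; last by rewrite addr0.
  by rewrite -iN ir in nr.
rewrite [RHS](eq_bigr (fun i => cst (if i \in r then e i else 0) * x ^ i
   + cst (if i == n then c else 0) * x ^ i)); last first.
  by move=> i _; rewrite rmorphD mulrDl.
rewrite big_split addrC /=; congr (_ + _).
  by rewrite big_seq_cond [RHS]big_seq_cond; apply: eq_bigr => i /andP[-> _].
rewrite big_mkcond (bigD1_seq n) //= pn eqxx big1 ?addr0 // => i /negPf ->.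
by rewrite rmorph0 mul0r if_same.
Qed.

(* The rank of x^n in the order 1 < x^-1 < x < x^-2 < x^2 < ..., and the
   exponent of given rank. *)
Definition rank n : nat := if 0 <= n then `|n|.*2 else `|n|.*2.-1.
Definition exponent (k : nat) : int := if odd k then - (uphalf k)%:Z else k./2%:Z.

Lemma exponentK : cancel exponent rank.
Proof.
move=> k; rewrite /rank /exponent; have := odd_double_half k.
case: (odd k) => kE; last exact: kE.
by have -> : uphalf k = k./2.+1 by [rewrite uphalf_half; lia]; exact: kE.
Qed.

Lemma rankK : cancel rank exponent.
Proof.
move=> n; rewrite /exponent /rank; case: (boolP (0 <= n)) => n0.
  by rewrite odd_double doubleK; lia.
have -> : `|n|.*2.-1 = (`|n|.-1).*2.+1 by lia.
by rewrite /= odd_double /= doubleK; lia.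
Qed.

Lemma mon_lt_rank n m : mon_lt n m = (rank n < rank m)%N.
Proof.
rewrite /mon_lt /rank.
by case: (boolP (0 <= n)) => n0; case: (boolP (0 <= m)) => m0; lia.
Qed.

Definition low (k : nat) := lspan (fun n => rank n < k)%N.

Lemma monic_low m f : monic_at m f <-> low (rank m) (f - x ^ m).
Proof.
rewrite monic_atP; split; apply: sub_lspan => n; by rewrite mon_lt_rank.
Qed.

Lemma le_low k l f : (k <= l)%N -> low k f -> low l f.
Proof. by move=> kl; apply: sub_lspan => n /leq_trans; apply. Qed.

Lemma low0 f : low 0 f -> f = 0.
Proof. by case. Qed.

Lemma lowS k f : low k.+1 f ->
  exists c g, low k g /\ f = cst c * x ^ exponent k + g.
Proof.
elim=> [|c n h].
  by exists 0, 0; rewrite rmorph0 mul0r addr0; split; [exact: lspan0|].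
rewrite ltnS leq_eqVlt => /orP[/eqP nk|nk] _ [e [g [kg ->]]].
  exists (c + e), g; split=> //; by rewrite -nk rankK rmorphD mulrDl addrA.
exists e, (cst c * x ^ n + g); split; first by apply: lspan_cons.
by rewrite addrCA.
Qed.

Lemma low_free k c : low k (cst c * x ^ exponent k) -> c = 0.
Proof. by apply: lspan_free; rewrite exponentK ltnn. Qed.

End LaurentSpan.

(** * Triangular operators *)

Section Triangular.
Variable R : realType.
Local Notation C := (complex R).
Local Notation Cx := {fraction {poly (complex R)}}.
Local Notation x := (xx R).
Variables (Y : Cx -> Cx) (ev : nat -> C).
Hypothesis YD : {morph Y : f g / f + g}.
Hypothesis YZ : forall c f, Y (cst c * f) = cst c * Y f.
Hypothesis Ytri :
  forall k, low k (Y (x ^ exponent k) - cst (ev k) * x ^ exponent k).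

(* Y - mu is triangular with diagonal ev k - mu, so it is invertible on low k as
   soon as mu avoids the first k diagonal entries. *)
Let shift mu f := Y f - cst mu * f.

Let shiftE mu k c g : shift mu (cst c * x ^ exponent k + g) =
  cst (c * (ev k - mu)) * x ^ exponent k
  + (cst c * (Y (x ^ exponent k) - cst (ev k) * x ^ exponent k) + shift mu g).
Proof. by rewrite /shift YD YZ rmorphM rmorphB; ring. Qed.

Let low_shift mu k f : low k f -> low k (shift mu f).
Proof.
elim: k f => [|k IH] f kf.
  have Y0 : Y 0 = 0 by rewrite -(mul0r 1) -(rmorph0 (@cst R)) YZ rmorph0 !mul0r.
  by rewrite (low0 kf) /shift Y0 mulr0 subrr; exact: lspan0.
have [c [g [kg ->]]] := lowS kf; rewrite shiftE.
apply: lspanD; first by apply/lspanZ/lspanX; rewrite exponentK.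
by apply: lspanD; [apply/lspanZ|]; apply: le_low (leqnSn k) _ => //; apply: IH.
Qed.

Lemma triangular_stable k f : low k f -> low k (Y f).
Proof.
by move=> kf; have := low_shift 0 kf; rewrite /shift rmorph0 mul0r subr0.
Qed.

Let eigen_top mu k f : ev k != mu -> low k.+1 f -> Y f = cst mu * f -> low k f.
Proof.
move=> kmu /lowS[c [g [kg ->]]] Yf.
suff -> : c = 0 by rewrite rmorph0 mul0r add0r.
have : shift mu (cst c * x ^ exponent k + g) = 0 by rewrite /shift Yf subrr.
rewrite shiftE => /eqP; rewrite addr_eq0 => /eqP top.
have /low_free/eqP : low k (cst (c * (ev k - mu)) * x ^ exponent k).
  by rewrite top; apply/lspanN/lspanD; [apply/lspanZ/Ytri|apply: low_shift].
by rewrite mulf_eq0 subr_eq0 (negPf kmu) orbF => /eqP.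
Qed.

Lemma eigen_low_eq0 mu k f : (forall i, (i < k)%N -> ev i != mu) ->
  low k f -> Y f = cst mu * f -> f = 0.
Proof.
elim: k => [|k IH] evk kf Yf; first exact: low0.
apply: IH => // [i ik|]; first by apply: evk; apply: ltnW.
by apply: eigen_top kf Yf; apply: evk.
Qed.

(** Back substitution: the leading coefficient of [h] has to be c / (ev k - mu), and what it leaves
    of [g] is one rank lower, where induction applies. *)
Lemma solve_low mu k g : (forall i, (i < k)%N -> ev i != mu) ->
  low k g -> exists2 h, low k h & Y h - cst mu * h = g.
Proof.
elim: k g => [|k IH] g evk kg.
  by exists 0; [exact: lspan0|rewrite (low0 kg); exact: low0 (low_shift mu (lspan0 _ _))].
have [c [g' [kg' ->]]] := lowS kg.
have evkmu : ev k - mu != 0 by rewrite subr_eq0 evk.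
set e := c / (ev k - mu).
have [||h kh hE] := IH (g' - cst e * (Y (x ^ exponent k) - cst (ev k) * x ^ exponent k)).
- by move=> i ik; apply: evk; apply: ltnW.
- by apply: lspanB => //; apply/lspanZ/Ytri.
exists (cst e * x ^ exponent k + h).
  apply: lspanD; first by apply/lspanZ/lspanX; rewrite exponentK.
  exact: le_low (leqnSn k) kh.
rewrite -/(shift _ _) shiftE [shift _ _]hE divfK //; ring.
Qed.

(** The monomial is corrected by the solution [h] in [low k] of (Y - ev k) h = (Y - ev k)
    x^(exponent k). *)
Lemma eigen_exists k : (forall i, (i < k)%N -> ev i != ev k) ->
  exists f, low k (f - x ^ exponent k) /\ Y f = cst (ev k) * f.
Proof.
move=> evk; have [h kh hE] := solve_low evk (Ytri k).
exists (x ^ exponent k - h); split.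
  by rewrite addrAC subrr add0r; apply: lspanN.
apply/eqP; rewrite -subr_eq0; apply/eqP.
have YN : Y (- h) = - Y h by rewrite -mulN1r -(rmorphN1 (@cst R)) YZ rmorphN1 mulN1r.
transitivity (Y (x ^ exponent k) - cst (ev k) * x ^ exponent k
  - (Y h - cst (ev k) * h)); first by rewrite YD YN; ring.
by rewrite hE subrr.
Qed.

(** A leading monomial of rank other than k is excluded by [eigen_top]; at rank k, subtracting a
    multiple of [g] leaves an eigenfunction in [low k], hence 0. *)
Lemma eigen_multiple k K f g : (forall i, i != k -> ev i != ev k) ->
  low k (g - x ^ exponent k) -> Y g = cst (ev k) * g ->
  low K f -> Y f = cst (ev k) * f -> exists c, f = cst c * g.
Proof.
move=> evk kg Yg; elim: K => [|K IH] Kf Yf.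
  by exists 0; rewrite (low0 Kf) rmorph0 mul0r.
have [Kk|Kk] := eqVneq K k; last by apply: IH => //; apply: eigen_top Kf Yf; apply: evk.
move: Kf; rewrite Kk => /lowS[c [h [kh fE]]]; exists c.
apply/eqP; rewrite -subr_eq0; apply/eqP.
have fN : f - cst c * g = f + cst (- c) * g by rewrite rmorphN mulNr.
apply: (@eigen_low_eq0 (ev k) k).
- by move=> i ik; apply: evk; rewrite ltn_eqF.
- rewrite fE (_ : _ - _ = h - cst c * (g - x ^ exponent k)); last by ring.
  by apply: lspanB => //; apply: lspanZ.
by rewrite fN YD YZ Yf Yg; ring.
Qed.

End Triangular.

(** * Demazure-Lusztig operators *)

(* y^(m-1) + y^(m-3) + ... + y^(1-m), the Chebyshev polynomial U_(m-1) evaluated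
   at (y + 1/y) / 2. *)
Fixpoint chebU (F : fieldType) (y : F) (m : nat) : F :=
  if m is m'.+1 then y ^+ m' + y^-1 * chebU y m' else 0.

Section ChebU.
Variables (F : fieldType) (y : F).
Hypothesis y0 : y != 0.

Lemma mul_chebU m : y * chebU y m.+1 = y ^+ m.+1 + chebU y m.
Proof. by rewrite mulrDr -exprS mulVKf. Qed.

Lemma mulV_chebU m : y^-1 * chebU y m.+1 = chebU y m + y ^- m.+1.
Proof.
elim: m => [|m IH]; first by rewrite /= mulr0 addr0 expr0 mulr1 add0r expr1.
rewrite [chebU y m.+2]/= mulrDr exprS mulKf // IH.
by rewrite mulrDr addrA -invfM -exprS -/(chebU y m.+1).
Qed.

Lemma chebU_geom m : (y - y^-1) * chebU y m = y ^+ m - y ^- m.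
Proof.
case: m => [|m]; first by rewrite /= mulr0 expr0 invr1 subrr.
by rewrite mulrBl mul_chebU mulV_chebU opprD addrA addrK.
Qed.

Lemma chebUSS m : chebU y m.+2 = y ^+ m.+1 + (chebU y m + y ^- m.+1).
Proof. by rewrite -mulV_chebU. Qed.

End ChebU.

(* f and g stand for the values of a function at a point and at its reflection,
   which exchanges y and 1/y. *)
Definition dl (F : fieldType) (k u y f g : F) : F :=
  k * f + k^-1 * ((1 - k * u * y) * (1 + k * u^-1 * y) / (1 - y ^+ 2)) * (g - f).

Lemma rmorph_dl (F K : fieldType) (phi : {rmorphism F -> K}) k u y f g :
  phi (dl k u y f g) = dl (phi k) (phi u) (phi y) (phi f) (phi g).
Proof.
by rewrite /dl !(rmorphD, rmorphN, rmorphM, fmorphV, rmorphXn, rmorph1).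
Qed.

Section DemazureLusztig.
Variables (F : fieldType) (k u y : F).
Hypotheses (k0 : k != 0) (u0 : u != 0) (y0 : y != 0) (y2 : y ^+ 2 != 1).

Lemma one_sub_sqr_neq0 : 1 - y ^+ 2 != 0.
Proof. by rewrite subr_eq0 eq_sym y2. Qed.

Lemma dl_sym f : dl k u y f f = k * f.
Proof. by rewrite /dl subrr mulr0 addr0. Qed.

(** The Hecke relation (T - k)(T + k^-1) = 0: at the reflected point y is inverted and the two
    values trade places. *)
Lemma dl_quadratic f g :
  dl k u y (dl k u y f g) (dl k u y^-1 g f) = (k - k^-1) * dl k u y f g + f.
Proof.
rewrite /dl; field.
by rewrite ?one_sub_sqr_neq0 k0 u0 y0 ?subr_eq0 ?y2 // eq_sym y2.
Qed.

Lemma dl_pow m : dl k u y (y ^+ m.+1) (y ^- m.+1) = k^-1 * y ^- m.+1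
  + (k^-1 - k) * chebU y m - (u - u^-1) * chebU y m.+1.
Proof.
have e1 := mul_chebU y0 m; have e2 := mulV_chebU y0 m.
(* Both powers are expressed by two consecutive values of [chebU], which [field] treats as
   indeterminates. *)
have -> : y ^- m.+1 = y^-1 * chebU y m.+1 - chebU y m by rewrite e2 addrC addKr.
have -> : y ^+ m.+1 = y * chebU y m.+1 - chebU y m by rewrite e1 addrK.
rewrite /dl; field.
by rewrite ?one_sub_sqr_neq0 k0 u0 y0 ?subr_eq0 ?y2 // eq_sym y2.
Qed.

Lemma dl_powV m : dl k u y (y ^- m.+1) (y ^+ m.+1) =
  (k - k^-1) * y ^- m.+1 + k * y ^+ m.+1
  + (k - k^-1) * chebU y m + (u - u^-1) * chebU y m.+1.
Proof.
have e1 := mul_chebU y0 m; have e2 := mulV_chebU y0 m.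
have -> : y ^- m.+1 = y^-1 * chebU y m.+1 - chebU y m by rewrite e2 addrC addKr.
have -> : y ^+ m.+1 = y * chebU y m.+1 - chebU y m by rewrite e1 addrK.
rewrite /dl; field.
by rewrite ?one_sub_sqr_neq0 k0 u0 y0 ?subr_eq0 ?y2 // eq_sym y2.
Qed.

End DemazureLusztig.

(** * Demazure-Lusztig operators on rational functions *)

Section HeckeOperator.
Variable R : realType.
Local Notation C := (complex R).
Local Notation Cx := {fraction {poly (complex R)}}.
Local Notation x := (xx R).
Implicit Types (f g h : Cx) (c e : C) (n : int).

(** A space [low k] need not be stable under T1 and T0 separately; these symmetric windows of
    exponents are. *)
Definition inner (m : nat) : Cx -> Prop := lspan (fun n => `|n| < m)%N.

Lemma innerS m l f : (m <= l)%N -> inner m f -> inner l f.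
Proof. by move=> ml; apply: sub_lspan => n /leq_trans; apply. Qed.

Lemma inner_low m f : inner m f <-> low m.*2.-1 f.
Proof. by split; apply: sub_lspan => n; rewrite /rank; case: (boolP (0 <= n)); lia. Qed.

(* T_1 is the case y = x, i = 1/x, and T_0 is the case y = s/x, i = q/x. *)
Variables (k u : C) (y i : Cx).
Hypotheses (k0 : k != 0) (u0 : u != 0).
Hypotheses (ync : nonconst y) (inc : nonconst i).
Hypotheses (yi : subst y i = y^-1) (ii : subst i i = x).
Hypothesis y_inner : forall m n, (`|n| < m)%N -> inner m (y ^ n).
Hypothesis x_of_y : forall n, exists c l, `|l|%N = `|n|%N /\ x ^ n = cst c * y ^ l.

Definition hecke f := dl (cst k) (cst u) y f (subst f i).

Let cc c : c != 0 -> cst c != 0 :> Cx. Proof. by rewrite fmorph_eq0. Qed.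

Let y0 : y != 0.
Proof. by have := nonconstP 0 ync; rewrite rmorph0. Qed.

Let y2 : y ^+ 2 != 1.
Proof. by have := nonconstP 1 (nonconstX2 ync); rewrite rmorph1. Qed.

Lemma heckeD : {morph hecke : f g / f + g}.
Proof. by move=> f g; rewrite /hecke /dl substD //; ring. Qed.

Lemma heckeZ c f : hecke (cst c * f) = cst c * hecke f.
Proof. by rewrite /hecke /dl substM // subst_cst //; ring. Qed.

Lemma subst_subst f : subst (subst f i) i = f.
Proof.
by rewrite subst_comp // ii subst_id.
Qed.

Lemma hecke_subst f : subst (hecke f) i = dl (cst k) (cst u) y^-1 (subst f i) f.
Proof.
rewrite -[LHS]/(substm inc _) rmorph_dl /= /substm.
by rewrite yi subst_subst !subst_cst.
Qed.

Lemma hecke_quadratic f : hecke (hecke f) = cst (k - k^-1) * hecke f + f.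
Proof.
rewrite [LHS]/hecke hecke_subst (dl_quadratic (cc k0) (cc u0) y0 y2).
by rewrite rmorphB fmorphV.
Qed.

Lemma hecke_sym f : subst f i = f -> hecke f = cst k * f.
Proof. by move=> fi; rewrite /hecke fi dl_sym. Qed.

Lemma chebU_inner m : inner m (chebU y m).
Proof.
(* lia would otherwise record these as dependencies. *)
clear k u k0 u0.
(* The recursion [chebUSS] has step two, so two consecutive cases are carried along. *)
suff : inner m (chebU y m) /\ inner m.+1 (chebU y m.+1) by case.
elim: m => [|m [IH IHS]].
  split; first exact: lspan0.
  by rewrite /= mulr0 addr0 exprnP; apply: y_inner.
split; first exact: IHS.
rewrite (chebUSS y0); apply: lspanD; first by rewrite exprnP; apply: y_inner; lia.
apply: lspanD; first by apply: innerS IH; lia.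
by rewrite exprnN; apply: y_inner; lia.
Qed.

Lemma hecke_pow m : inner m.+1 (hecke (y ^ m.+1%:Z) - cst k^-1 * y ^ (- m.+1%:Z)).
Proof.
rewrite /hecke (substXz inc) yi -!exprnN -!exprnP exprVn.
rewrite (dl_pow (cc k0) (cc u0) y0 y2).
rewrite (_ : _ - _ = cst (k^-1 - k) * chebU y m - cst (u - u^-1) * chebU y m.+1).
  by apply: lspanB; apply: lspanZ; [apply: innerS (chebU_inner m)|apply: chebU_inner].
by rewrite !rmorphB !fmorphV /=; ring.
Qed.

Lemma hecke_powV m : inner m.+1 (hecke (y ^ (- m.+1%:Z)) -
  (cst (k - k^-1) * y ^ (- m.+1%:Z) + cst k * y ^ m.+1%:Z)).
Proof.
rewrite /hecke (substXz inc) yi -!exprnN -!exprnP exprVn invrK.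
rewrite (dl_powV (cc k0) (cc u0) y0 y2).
rewrite (_ : _ - _ = cst (k - k^-1) * chebU y m + cst (u - u^-1) * chebU y m.+1).
  by apply: lspanD; apply: lspanZ; [apply: innerS (chebU_inner m)|apply: chebU_inner].
by rewrite !rmorphB !fmorphV /=; ring.
Qed.

Lemma hecke_inner m f : inner m f -> inner m (hecke f).
Proof.
elim=> [|c n g nm _ IH].
  have -> : hecke 0 = 0 by rewrite /hecke subst0 // /dl subrr !mulr0 addr0.
  exact: lspan0.
rewrite heckeD heckeZ; apply: lspanD => //; apply: lspanZ.
have [e [l [ln ->]]] := x_of_y n; rewrite heckeZ; apply: lspanZ.
rewrite -ln in nm.
have sub h h' : inner m (h - h') -> inner m h' -> inner m h.
  by move=> hh' hm; rewrite -[h](subrK h'); apply: lspanD.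
case: l nm {ln} => [[|l]|l] nm.
- by rewrite expr0z hecke_sym ?subst1 //; apply/lspanZ/(y_inner (n := 0)).
- apply: sub (innerS (ltnW nm) (hecke_pow l)) _; apply/lspanZ/y_inner; lia.
rewrite NegzE in nm *.
apply: sub (innerS (ltnW nm) (hecke_powV l)) _.
by apply: lspanD; apply/lspanZ/y_inner; lia.
Qed.

End HeckeOperator.

(** * The operators [T0], [T1] and [Y] *)

Section Operators.
Variable R : realType.
Local Notation C := (complex R).
Local Notation Cx := {fraction {poly (complex R)}}.
Local Notation x := (xx R).
Implicit Types (f g h : Cx) (c e : C) (n : int).

Variables (q s k0 k1 u0 u1 : C).
Hypotheses (hq0 : q != 0) (hs : s ^+ 2 = q).
Hypotheses (hk0 : k0 != 0) (hk1 : k1 != 0) (hu0 : u0 != 0) (hu1 : u1 != 0).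

Lemma sqrt_neq0 : s != 0.
Proof. by apply: contraNneq hq0 => s0; rewrite -hs s0 expr0n. Qed.

Lemma cst_neq0 c : c != 0 -> cst c != 0 :> Cx.
Proof. by rewrite fmorph_eq0. Qed.

Lemma xV_nonconst : nonconst x^-1.
Proof. exact: nonconstV (xx_nonconst R). Qed.

Lemma cstV_nonconst c : c != 0 -> nonconst (cst c * x^-1).
Proof. by move=> c0; apply: cstM_nonconst c0 xV_nonconst. Qed.

Lemma subst_xV : subst x^-1 x^-1 = x.
Proof. by rewrite (substV xV_nonconst) (subst_xx xV_nonconst) invrK. Qed.

Lemma subst_cstV c e : e != 0 ->
  subst (cst c * x^-1) (cst e * x^-1) = cst (c / e) * x.
Proof.
move=> e0; have nc := cstV_nonconst e0.
rewrite (substM nc) (subst_cst nc) (substV nc) (subst_xx nc).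
by rewrite invfM invrK mulrA rmorphM fmorphV.
Qed.

Lemma subst_sV_qV : subst (cst s * x^-1) (cst q * x^-1) = (cst s * x^-1)^-1.
Proof.
rewrite subst_cstV // -hs expr2 invfM mulrA divff ?sqrt_neq0 // mul1r.
by rewrite invfM invrK fmorphV.
Qed.

Lemma subst_qV_qV : subst (cst q * x^-1) (cst q * x^-1) = x.
Proof. by rewrite subst_cstV // divff // rmorph1 mul1r. Qed.

Lemma exprz_sV n : (cst s * x^-1) ^ n = cst (s ^ n) * x ^ (- n).
Proof. by rewrite expfzMl exprz_inv (fmorphXz (@cst R)). Qed.

Lemma x_inner m n : (`|n| < m)%N -> inner m (x ^ n).
Proof. by move=> nm; apply: lspanX. Qed.

Lemma sV_inner m n : (`|n| < m)%N -> inner m ((cst s * x^-1) ^ n).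
Proof. by move=> nm; rewrite exprz_sV; apply/lspanZ/lspanX; rewrite abszN. Qed.

Lemma x_of_x n : exists c l, `|l|%N = `|n|%N /\ x ^ n = cst c * x ^ l.
Proof. by exists 1, n; rewrite rmorph1 mul1r. Qed.

Lemma T1E f : T1 k1 u1 f = hecke k1 u1 x x^-1 f.
Proof.
rewrite /T1 /hecke /dl /AWa /AWb fmorphV rmorphN !rmorphM fmorphV /=.
by rewrite mulNr opprK.
Qed.

(** With y = s/x, the relation s^2 = q gives 1 - q x^-2 = 1 - y^2 and c/x = k0 u0 y. *)
Lemma T0E f : T0 q s k0 u0 f =
  hecke k0 u0 (cst s * x^-1) (cst q * x^-1) f.
Proof.
rewrite /T0 /hecke /dl /AWc /AWd fmorphV rmorphN !rmorphM fmorphV /= -hs rmorphXn /=.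
rewrite mulNr opprK exprMn exprVn; congr (_ + _ * (_ * _ / _) * _); ring.
Qed.

Local Notation t1 := (T1 k1 u1).
Local Notation t0 := (T0 q s k0 u0).
Local Notation Y := (AWY q s k0 k1 u0 u1).

Lemma T1D : {morph t1 : f g / f + g}.
Proof. move=> f g; rewrite !T1E; exact: (heckeD _ _ _ xV_nonconst). Qed.

Lemma T1Z c f : t1 (cst c * f) = cst c * t1 f.
Proof. rewrite !T1E; exact: (heckeZ _ _ _ xV_nonconst). Qed.

Lemma T0D : {morph t0 : f g / f + g}.
Proof. move=> f g; rewrite !T0E; exact: (heckeD _ _ _ (cstV_nonconst hq0)). Qed.

Lemma T0Z c f : t0 (cst c * f) = cst c * t0 f.
Proof. rewrite !T0E; exact: (heckeZ _ _ _ (cstV_nonconst hq0)). Qed.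

Lemma YD : {morph Y : f g / f + g}.
Proof. by move=> f g; rewrite /AWY T0D T1D. Qed.

Lemma YZ c f : Y (cst c * f) = cst c * Y f.
Proof. by rewrite /AWY T0Z T1Z. Qed.

Lemma T1_quadratic f : t1 (t1 f) = cst (k1 - k1^-1) * t1 f + f.
Proof.
rewrite !T1E.
exact: (hecke_quadratic hk1 hu1 (xx_nonconst R) xV_nonconst (subst_xx xV_nonconst)
 subst_xV).
Qed.

Lemma T0_quadratic f : t0 (t0 f) = cst (k0 - k0^-1) * t0 f + f.
Proof.
rewrite !T0E.
exact: (hecke_quadratic hk0 hu0 (cstV_nonconst sqrt_neq0) (cstV_nonconst hq0)
  subst_sV_qV subst_qV_qV).
Qed.

Lemma T1_inner m f : inner m f -> inner m (t1 f).
Proof.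
rewrite T1E.
exact: (hecke_inner hk1 hu1 (xx_nonconst R) xV_nonconst (subst_xx xV_nonconst)
  x_inner x_of_x).
Qed.

Lemma T1_pow m : inner m.+1 (t1 (x ^ m.+1%:Z) - cst k1^-1 * x ^ (- m.+1%:Z)).
Proof.
rewrite T1E.
exact: (hecke_pow hk1 hu1 (xx_nonconst R) xV_nonconst (subst_xx xV_nonconst) x_inner).
Qed.

Lemma T1_powV m : inner m.+1 (t1 (x ^ (- m.+1%:Z)) -
  (cst (k1 - k1^-1) * x ^ (- m.+1%:Z) + cst k1 * x ^ m.+1%:Z)).
Proof.
rewrite T1E.
exact: (hecke_powV hk1 hu1 (xx_nonconst R) xV_nonconst (subst_xx xV_nonconst) x_inner).
Qed.

Lemma expq n : q ^ n = s ^ n * s ^ n.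
Proof. by rewrite -hs expr2 expfzMl. Qed.

(** A positive power of s/x is a negative power of x, so [hecke_pow] applies here; the two powers of
    s that arise combine into one of q. *)
Lemma T0_powV m :
  inner m.+1 (t0 (x ^ (- m.+1%:Z)) - cst (k0^-1 * q ^ (- m.+1%:Z)) * x ^ m.+1%:Z).
Proof.
have := hecke_pow hk0 hu0 (cstV_nonconst sqrt_neq0) (cstV_nonconst hq0)
  subst_sV_qV sV_inner m.
rewrite -T0E !exprz_sV T0Z opprK => /(lspanZ (s ^ (- m.+1%:Z))).
move: (t0 (x ^ (- m.+1%:Z))) => f.
rewrite mulrBr !mulrA -!rmorphM -expfzDr ?sqrt_neq0 // addNr expr0z rmorph1 mul1r.
by rewrite expq (_ : k0^-1 * _ = s ^ (- m.+1%:Z) * k0^-1 * s ^ (- m.+1%:Z)) //; ring.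
Qed.

Lemma T0_pow m : inner m.+1 (t0 (x ^ m.+1%:Z) -
  (cst (k0 - k0^-1) * x ^ m.+1%:Z + cst (k0 * q ^ m.+1%:Z) * x ^ (- m.+1%:Z))).
Proof.
have := hecke_powV hk0 hu0 (cstV_nonconst sqrt_neq0) (cstV_nonconst hq0)
  subst_sV_qV sV_inner m.
rewrite -T0E !exprz_sV T0Z opprK => /(lspanZ (s ^ (m.+1%:Z))).
have ss : s ^ m.+1%:Z * s ^ (- m.+1%:Z) = 1.
  by rewrite -expfzDr ?sqrt_neq0 // subrr expr0z.
move: (t0 (x ^ m.+1%:Z)) => f.
rewrite mulrBr mulrDr !mulrA -!rmorphM /= ss rmorph1 mul1r.
rewrite expq (_ : k0 * _ = s ^ m.+1%:Z * k0 * s ^ m.+1%:Z); last by ring.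
by rewrite [_ * s ^ (- _)]mulrAC ss mul1r.
Qed.

End Operators.

(** * Modules over the affine Hecke algebra *)

Section HeckeModule.
Variables (F K : fieldType) (phi : {rmorphism F -> K}).
Variables (k0 k1 : F) (t0 t1 : K -> K).
Hypotheses (hk0 : k0 != 0) (hk1 : k1 != 0).
Hypotheses (t0D : {morph t0 : f g / f + g}) (t1D : {morph t1 : f g / f + g}).
Hypothesis t0Z : forall c f, t0 (phi c * f) = phi c * t0 f.
Hypothesis t1Z : forall c f, t1 (phi c * f) = phi c * t1 f.
Hypothesis t0_quadratic : forall f, t0 (t0 f) = phi (k0 - k0^-1) * t0 f + f.
Hypothesis t1_quadratic : forall f, t1 (t1 f) = phi (k1 - k1^-1) * t1 f + f.

(* Y + Y^-1 for Y = t1 t0, using t^-1 = t - k + k^-1. *)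
Definition ysym f := t1 (t0 f)
  + (t0 (t1 f - phi (k1 - k1^-1) * f)
     - phi (k0 - k0^-1) * (t1 f - phi (k1 - k1^-1) * f)).

Let t0B f g : t0 (f - g) = t0 f - t0 g.
Proof. by rewrite t0D -mulN1r -(rmorphN1 phi) t0Z rmorphN1 mulN1r. Qed.

Let t1B f g : t1 (f - g) = t1 f - t1 g.
Proof. by rewrite t1D -mulN1r -(rmorphN1 phi) t1Z rmorphN1 mulN1r. Qed.

(** Applying Y to (Y + Y^-1) f = c f gives Y^2 f + f = c Y f; in the proof [g] is t1^-1 f. *)
Lemma ysym_quadratic c f : ysym f = phi c * f ->
  t1 (t0 (t1 (t0 f))) = phi c * t1 (t0 f) - f.
Proof.
set g := t1 f - phi (k1 - k1^-1) * f => fE.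
have t1g : t1 g = f by rewrite /g t1B t1Z t1_quadratic addrAC subrr add0r.
have : t1 (t0 (ysym f)) = phi c * t1 (t0 f) by rewrite fE t0Z t1Z.
rewrite /ysym -/g t0D t0B t0Z t0_quadratic [_ + g]addrC addrK t1D t1g => <-.
by rewrite addrK.
Qed.

(** The factorization (Y - ga^-1)(Y - ga) f = 0 of the quadratic relation. *)
Lemma ysym_split (ga : F) f : ga != 0 -> ysym f = phi (ga + ga^-1) * f ->
  t1 (t0 (t1 (t0 f) - phi ga * f)) = phi ga^-1 * (t1 (t0 f) - phi ga * f).
Proof.
move=> hga /ysym_quadratic Yf; rewrite t0B t0Z t1B t1Z Yf (rmorphD phi) /=.
rewrite (_ : _ - _ = phi ga^-1 * t1 (t0 f) - 1 * f); last by ring.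
by rewrite -(rmorph1 phi) -(mulVf hga) (rmorphM phi) /=; ring.
Qed.

Variables (ga : F) (N : K).
Hypotheses (hga : ga != 0) (YN : t1 (t0 N) = phi ga^-1 * N).

(** Up to a scalar, the projection of [N] onto the k1-eigenspace of [t1]. The factor k1^-1 will make
    it monic, as T1 x^(-m) has coefficient k1 at x^m. *)
Definition symmetrize := phi k1^-1 * (t1 N + phi k1^-1 * N).

Local Notation E := symmetrize.

Let ph c : c != 0 -> phi c != 0. Proof. by rewrite fmorph_eq0. Qed.

Lemma t1_N : t1 N = phi k1 * E - phi k1^-1 * N.
Proof. by rewrite /E mulrA -rmorphM divff // rmorph1 mul1r addrK. Qed.

Lemma symmetrize_sub X :
  E - X = phi k1^-1 * ((t1 N - phi k1 * X) + phi k1^-1 * N).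
Proof. by rewrite /E fmorphV; field; rewrite ph. Qed.

Lemma t1_sym : t1 E = phi k1 * E.
Proof.
rewrite /E t1Z t1D t1Z t1_quadratic !rmorphB !fmorphV /=.
by field; rewrite ph.
Qed.

(** The vector is k1^-1 (t1 - k1) N. *)
Lemma t1_antisym : t1 (E - phi (1 + k1^-1 * k1^-1) * N)
  = phi (- k1^-1) * (E - phi (1 + k1^-1 * k1^-1) * N).
Proof.
rewrite t1B t1Z t1_sym t1_N !(rmorphD, rmorphM, rmorphN, rmorph1, fmorphV) /=.
by move: E => e; field; rewrite ph.
Qed.

(** From Y N = ga^-1 N, t0 N = ga^-1 t1^-1 N, where t1^-1 = t1 - k1 + k1^-1. *)
Lemma t0_N : t0 N = phi (ga^-1 * k1) * (E - N).
Proof.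
have : t1 (t1 (t0 N)) = phi ga^-1 * t1 N by rewrite YN t1Z.
rewrite t1_quadratic YN t1_N => /(canRL (addKr _)) ->.
rewrite !(rmorphM, rmorphB, fmorphV) /=.
by field; rewrite !ph.
Qed.

Lemma t0_sym :
  t0 E = phi (k0 - k0^-1 + ga^-1 * k1) * (E - N) + phi (ga / k1) * N.
Proof.
have EN : E = phi (ga / k1) * t0 N + N.
  rewrite t0_N mulrA -rmorphM (_ : ga / k1 * _ = 1) ?rmorph1 ?mul1r ?subrK //.
  by field; rewrite hga hk1.
rewrite [in LHS]EN t0D t0Z t0_quadratic t0_N.
rewrite !(rmorphD, rmorphM, rmorphB, fmorphV) /=.
by field; rewrite !ph.
Qed.

Lemma Y_sym : t1 (t0 E) = phi ga * E
  + phi ((k0 - k0^-1) / k1 + ga^-1 - ga / (k1 * k1)) * N.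
Proof.
rewrite t0_sym t1D !t1Z t1B t1_sym t1_N !(rmorphD, rmorphM, rmorphB, fmorphV) /=.
by field; rewrite !ph.
Qed.

(** In the basis E, N the operator Y is triangular with diagonal ga, ga^-1 and off-diagonal entry b,
    which determines the eigenvector for ga. *)
Lemma Y_eigen (b := (k0 - k0^-1) / k1 + ga^-1 - ga / (k1 * k1))
    (f := E + phi (b / (ga - ga^-1)) * N) :
  ga - ga^-1 != 0 -> t1 (t0 f) = phi ga * f.
Proof.
move=> gap; rewrite /f t0D t0Z t1D t1Z Y_sym YN -/b.
have {1}-> : b = b / (ga - ga^-1) * (ga - ga^-1) by rewrite divfK.
by move: (b / _) (E) => e g; rewrite (rmorphM phi) (rmorphB phi) /=; ring.
Qed.

Lemma ysymD f g : ysym (f + g) = ysym f + ysym g.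
Proof. by rewrite /ysym !t0B !t0Z !t1D !t0D !t1D; ring. Qed.

Lemma ysymZ c f : ysym (phi c * f) = phi c * ysym f.
Proof. by rewrite /ysym !(t0B, t0Z, t1Z); ring. Qed.

Lemma ysym_N : ysym N = phi (ga + ga^-1) * N.
Proof.
rewrite /ysym YN t1_N !t0B (t0Z _ E) !(t0Z _ N) t0_sym t0_N.
rewrite !(rmorphD, rmorphM, rmorphB, fmorphV) /=.
by field; rewrite !ph.
Qed.

(** Conceptually, Y + Y^-1 commutes with [t1], so its scalar on [N] is also its scalar on E; the
    proof computes with the explicit matrices. *)
Lemma ysym_sym : ysym E = phi (ga + ga^-1) * E.
Proof.
rewrite /ysym Y_sym t1_sym !t0B !(t0Z _ E) t0_sym.
rewrite !(rmorphD, rmorphM, rmorphB, fmorphV) /=.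
by field; rewrite !ph.
Qed.

End HeckeModule.

(** * Existence and uniqueness of the polynomials *)

Section AskeyWilsonPolynomials.
Variable R : realType.
Local Notation C := (complex R).
Local Notation Cx := {fraction {poly (complex R)}}.
Local Notation x := (xx R).
Implicit Types (f g h : Cx) (c e : C) (n : int).

Variables (q s k0 k1 u0 u1 : C).
Hypotheses (hq0 : q != 0) (hs : s ^+ 2 = q).
Hypotheses (hk0 : k0 != 0) (hk1 : k1 != 0) (hu0 : u0 != 0) (hu1 : u1 != 0).
Hypothesis hq : forall j : nat, (0 < j)%N -> q ^+ j != 1.
Hypothesis hk : forall j : nat, (0 < j)%N -> k0 ^+ 2 * k1 ^+ 2 * q ^+ j != 1.

Local Notation t1 := (T1 k1 u1).
Local Notation t0 := (T0 q s k0 u0).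
Local Notation Y := (AWY q s k0 k1 u0 u1).
Local Notation ga := (gamma q k0 k1).
Local Notation P := (nonsymAW q s k0 k1 u0 u1).

Let kk0 : k0 * k1 != 0. Proof. exact: mulf_neq0. Qed.

Lemma gamma_nat m : ga m%:Z = k0 * k1 * q ^+ m.
Proof. by rewrite /gamma /eps /= expr1z. Qed.

Lemma gammaN m : ga (- m.+1%:Z) = (ga m.+1%:Z)^-1.
Proof. by rewrite gamma_nat /gamma /eps /= invfM exprN1 -exprnN. Qed.

Lemma gamma_neq0 n : ga n != 0.
Proof. by rewrite mulf_neq0 ?expfz_neq0. Qed.

(** Indices of the same sign are separated because q is not a root of unity; for opposite signs,
    equality would give k0^2 k1^2 q^(i+j+1) = 1. *)
Lemma gamma_inj : injective ga.
Proof.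
have expq_inj i j : q ^+ i = q ^+ j -> i = j.
  wlog ij : i j / (i <= j)%N => [H|].
    by case: (leqP i j) => [|/ltnW] ij e; [apply: H|apply/esym/H].
  rewrite -(subnKC ij) exprD => /eqP.
  rewrite -subr_eq0 -{1}[q ^+ i]mulr1 -mulrBr mulf_eq0 expf_eq0 (negPf hq0) andbF /=.
  rewrite subr_eq0 eq_sym; case: (j - i)%N (hq (j := (j - i)%N)) => [|k].
    by rewrite addn0.
  by move=> /(_ isT) /negPf ->.
have cross i j : ga i%:Z <> ga (- j.+1%:Z).
  rewrite gammaN !gamma_nat => /eqP.
  rewrite -[_ == _](inj_eq (mulIf (_ : k0 * k1 * q ^+ j.+1 != 0))).
    rewrite mulVf ?mulf_neq0 ?expf_neq0 // => /eqP e.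
    have /eqP[] := hk (j := (i + j.+1)%N) ltac:(lia).
    by rewrite -e exprD; ring.
  by rewrite mulf_neq0 ?expf_neq0.
case=> i [] j; rewrite ?NegzE => e.
- by move: e; rewrite !gamma_nat => /(mulfI kk0)/expq_inj ->.
- by case: (cross _ _ e).
- by case: (cross _ _ (esym e)).
by move: e; rewrite !gammaN !gamma_nat => /invr_inj/(mulfI kk0)/expq_inj ->.
Qed.

Let sub_ex m f g : inner m (f - g) -> exists2 r, inner m r & f = g + r.
Proof. by exists (f - g) => //; rewrite addrC subrK. Qed.

Lemma Y_powV m :
  inner m.+1 (Y (x ^ (- m.+1%:Z)) - cst (ga (- m.+1%:Z)) * x ^ (- m.+1%:Z)).
Proof.
have [r ri e0] := sub_ex (T0_powV hq0 hs hk0 hu0 m).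
have [r1 r1i e1] := sub_ex (T1_pow hk1 hu1 m).
rewrite /AWY e0 T1D T1Z e1; set c := k0^-1 * _.
rewrite (_ : _ - _ = cst c * r1 + t1 r).
  by apply: lspanD; [apply: lspanZ|apply: T1_inner].
have -> : ga (- m.+1%:Z) = c * k1^-1.
  by rewrite gammaN gamma_nat /c !invfM -exprnN; ring.
by move: (t1 r) (c) => f d; rewrite (rmorphM (@cst R)) /=; ring.
Qed.

Lemma Y_pow m : exists c, inner m.+1
  (Y (x ^ m.+1%:Z) - (cst (ga m.+1%:Z) * x ^ m.+1%:Z + cst c * x ^ (- m.+1%:Z))).
Proof.
have [r ri e0] := sub_ex (T0_pow hq0 hs hk0 hu0 m).
have [r1 r1i e1] := sub_ex (T1_pow hk1 hu1 m).
have [r2 r2i e2] := sub_ex (T1_powV hk1 hu1 m).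
rewrite /AWY e0 !T1D !T1Z e1 e2; set a := k0 - _; set b := k0 * _.
exists (a / k1 + b * (k1 - k1^-1)).
rewrite (_ : _ - _ = cst a * r1 + cst b * r2 + t1 r).
  by apply: lspanD; [apply: lspanD; apply: lspanZ|apply: T1_inner].
have -> : ga m.+1%:Z = b * k1 by rewrite gamma_nat /b -exprnP; ring.
by move: (t1 r) (a) (b) => f d e; rewrite (rmorphD (@cst R)) !(rmorphM (@cst R)) /=; ring.
Qed.

Lemma AWY1 : Y 1 = cst (k0 * k1).
Proof.
have c1 := xV_nonconst R; have c2 := cstV_nonconst hq0.
rewrite /AWY T0E // hecke_sym ?subst1 // -[1](rmorph1 (@cst R)) T1Z.
by rewrite T1E hecke_sym ?subst_cst // rmorph1 mulr1 -rmorphM.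
Qed.

Let inner_rankN m f : inner m.+1 f <-> low (rank (- m.+1%:Z)) f.
Proof. exact: (inner_low m.+1 f). Qed.

(** The extra term in x^(-m) that arises from x^m ranks below x^m, and all other errors have
    exponents smaller in absolute value. *)
Lemma Y_triangular k :
  low k (Y (x ^ exponent k) - cst (ga (exponent k)) * x ^ exponent k).
Proof.
have {1}-> : k = rank (exponent k) by rewrite exponentK.
case: (exponent k) => [[|m]|m].
- by rewrite expr0z AWY1 gamma_nat mulr1 mulr1 subrr; exact: lspan0.
- have [c] := Y_pow m; move: (Y _) => f ci.
  rewrite -[f - _](subrK (cst c * x ^ (- m.+1%:Z))) -[f - _ - _]addrA -opprD.
  apply: lspanD; first by move/inner_low: ci; apply: le_low; rewrite /rank /=; lia.
  by apply/lspanZ/lspanX; rewrite /rank /=; lia.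
by rewrite NegzE; apply/inner_rankN; apply: Y_powV.
Qed.

Let evk k i : i != k -> ga (exponent i) != ga (exponent k).
Proof. by apply: contraNneq => /gamma_inj/(can_inj exponentK) ->. Qed.

Let Y_add := YD k0 k1 u0 u1 hq0 hs.
Let Y_scale := YZ k0 k1 u0 u1 hq0 hs.

Lemma nonsymAW_unique n f : is_nonsymAW q s k0 k1 u0 u1 n f -> P n = f.
Proof.
move=> fP; apply: xget_subset1 => // {f fP} f g [/monic_low fm Yf] [/monic_low gm Yg].
apply/eqP; rewrite -subr_eq0; apply/eqP.
apply: (eigen_low_eq0 Y_add Y_scale Y_triangular (mu := ga n) (k := rank n)).
- move=> i ni; have := evk (k := rank n) (i := i); rewrite rankK; apply.
  by rewrite ltn_eqF.
- by rewrite -[f](subrK (x ^ n)) -addrA -[x ^ n - g]opprB; apply: lspanB.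
by rewrite -mulN1r -(rmorphN1 (@cst R)) Y_add Y_scale Yf Yg; ring.
Qed.

Lemma nonsymAWP n : is_nonsymAW q s k0 k1 u0 u1 n (P n).
Proof.
suff [f fP] : exists f, is_nonsymAW q s k0 k1 u0 u1 n f.
  by rewrite (nonsymAW_unique fP).
have [|f] := eigen_exists Y_add Y_scale Y_triangular (k := rank n).
  by move=> i ni; apply: evk; rewrite ltn_eqF.
by rewrite rankK => -[fm Yf]; exists f; split=> //; apply/monic_low.
Qed.

Lemma nonsymAW0 : P 0 = 1.
Proof.
apply: nonsymAW_unique; split; last by rewrite AWY1 gamma_nat expr0 !mulr1.
by apply/monic_low; rewrite expr0z subrr; exact: lspan0.
Qed.

Lemma eigen_nonsymAW n K f : low K f -> Y f = cst (ga n) * f ->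
  exists c, f = cst c * P n.
Proof.
move=> Kf Yf; have [/monic_low Pm YP] := nonsymAWP n.
apply: (eigen_multiple Y_add Y_scale Y_triangular (k := rank n)) Kf _; rewrite ?rankK //.
by move=> i /evk; rewrite rankK.
Qed.

(** * The plane spanned by [P_M] and [P_(-M)], for M positive *)

Section Pair.
Variable m : nat.
Local Notation M := (m.+1).
Local Notation N := (P (- M%:Z)).
Local Notation E := (symmetrize (@cst R) k1 t1 N).

Lemma nonsymAWN_inner : inner M (N - x ^ (- M%:Z)).
Proof. by apply/inner_rankN; have [/monic_low] := nonsymAWP (- M%:Z). Qed.

Lemma Y_nonsymAWN : t1 (t0 N) = cst (ga M)^-1 * N.
Proof. by have [_] := nonsymAWP (- M%:Z); rewrite gammaN. Qed.

Let inner_rank f : inner M f -> low (rank M) f.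
Proof. by move/inner_low; apply: le_low; rewrite /rank /=; lia. Qed.

Let low_rank c : low (rank M) (cst c * x ^ (- M%:Z)).
Proof. by apply/lspanZ/lspanX; rewrite /rank /=; lia. Qed.

Lemma nonsymAWN_low : low (rank M) N.
Proof.
rewrite -[N](subrK (x ^ (- M%:Z))); apply: lspanD.
  by apply: inner_rank; exact: nonsymAWN_inner.
by have := low_rank 1; rewrite rmorph1 mul1r.
Qed.

Lemma T1_nonsymAWN_low : low (rank M) (t1 N - cst k1 * x ^ M%:Z).
Proof.
have [r ri ->] := sub_ex nonsymAWN_inner.
have [r2 r2i e2] := sub_ex (T1_powV hk1 hu1 m).
rewrite T1D e2 (_ : _ - _ = cst (k1 - k1^-1) * x ^ (- M%:Z) + r2 + t1 r).
  apply: lspanD; last by apply: inner_rank; apply: T1_inner.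
  by apply: lspanD; [exact: low_rank|exact: inner_rank].
by move: (t1 r) => f; ring.
Qed.

Lemma sym_monic : monic_at M E.
Proof.
apply/monic_low; rewrite symmetrize_sub //.
by apply/lspanZ/lspanD; [exact: T1_nonsymAWN_low|apply/lspanZ; exact: nonsymAWN_low].
Qed.

Let T0_add := T0D k0 u0 hq0 hs.
Let T1_add := T1D k1 u1.
Let T0_scale := T0Z k0 u0 hq0 hs.
Let T1_scale := T1Z k1 u1.
Let T0_quad := T0_quadratic hq0 hs hk0 hu0.
Let T1_quad := T1_quadratic hk1 hu1.
Let gM0 := gamma_neq0 M.

Let gap : ga M - (ga M)^-1 != 0.
Proof. by rewrite subr_eq0 -gammaN; apply/eqP => /gamma_inj; lia. Qed.

Definition sym_coef := ((k0 - k0^-1) / k1 + (ga M)^-1 - ga M / (k1 * k1))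
  / (ga M - (ga M)^-1).

Lemma nonsymAW_sym : P M%:Z = E + cst sym_coef * N.
Proof.
apply: nonsymAW_unique; split.
  apply/monic_low; rewrite addrAC; apply: lspanD; first exact/monic_low/sym_monic.
  by apply: lspanZ; exact: nonsymAWN_low.
exact: (Y_eigen hk0 hk1 T0_add T1_add T0_scale T1_scale T0_quad T1_quad gM0 Y_nonsymAWN).
Qed.

Lemma symmetrize_span : in_span_pm q s k0 k1 u0 u1 M E.
Proof.
exists 1, (- sym_coef); rewrite nonsymAW_sym; move: E N (sym_coef) => f g c.
by rewrite rmorph1 rmorphN; ring.
Qed.

Lemma in_span_monic f : in_span_pm q s k0 k1 u0 u1 M f -> monic_at M f ->
  exists e, f = P M%:Z + cst e * N.
Proof.
move=> [e1 [e2 fE]] /monic_low fm; exists e2; rewrite fE.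
suff -> : e1 = 1 by rewrite rmorph1 mul1r.
apply/eqP; rewrite -subr_eq0; apply/eqP.
have [/monic_low Pm _] := nonsymAWP M%:Z.
apply: (@lspan_free _ (fun n => (rank n < rank M)%N) _ M%:Z); first by rewrite ltnn.
suff <- : (f - x ^ M%:Z) - cst e1 * (P M%:Z - x ^ M%:Z) - cst e2 * N
    = cst (e1 - 1) * x ^ M%:Z.
  by apply: lspanB; [apply: lspanB => //; apply: lspanZ|apply/lspanZ/nonsymAWN_low].
by rewrite fE rmorphB rmorph1; move: (P _) N => g h; ring.
Qed.

(** The difference is e N with T1 (e N) = mu e N. Since [N] has no x^M term while T1 N has
    coefficient k1 there, e k1 = 0. *)
Lemma in_span_eigen_unique mu f g :
  in_span_pm q s k0 k1 u0 u1 M f -> monic_at M f -> t1 f = cst mu * f ->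
  in_span_pm q s k0 k1 u0 u1 M g -> monic_at M g -> t1 g = cst mu * g -> f = g.
Proof.
move=> fs fm fe gs gm ge.
have [e1 fE] := in_span_monic fs fm; have [e2 gE] := in_span_monic gs gm.
suff ee : e1 - e2 = 0 by rewrite fE gE -(subrK e2 e1) ee add0r.
have fgE : f = g + cst (e1 - e2) * N by rewrite fE gE rmorphB; ring.
move: fe; rewrite fgE T1D T1Z ge [RHS]mulrDr => /addrI ne.
have : (e1 - e2) * k1 = 0.
  apply: (@lspan_free _ (fun n => (rank n < rank M)%N) _ M%:Z); first by rewrite ltnn.
  rewrite (_ : _ * _ = cst mu * (cst (e1 - e2) * N)
    - cst (e1 - e2) * (t1 N - cst k1 * x ^ M%:Z)).
    by apply: lspanB; apply: lspanZ; [apply/lspanZ/nonsymAWN_low|exact: T1_nonsymAWN_low].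
  by rewrite -ne rmorphM; move: (t1 N) => h; ring.
by move/eqP; rewrite mulf_eq0 (negPf hk1) orbF => /eqP.
Qed.

Lemma symAW_E : symAW q s k0 k1 u0 u1 M = E.
Proof.
apply: xget_subset1; last first.
  by move=> f g [fs fm fe] [gs gm ge]; apply: (in_span_eigen_unique fs fm fe gs gm ge).
split; [exact: symmetrize_span|exact: sym_monic|].
exact: (t1_sym hk1 T1_add T1_scale T1_quad).
Qed.

Lemma antisymAW_E :
  antisymAW q s k0 k1 u0 u1 M = E - cst (1 + k1^-1 * k1^-1) * N.
Proof.
apply: xget_subset1; last first.
  by move=> f g [fs fm fe] [gs gm ge]; apply: (in_span_eigen_unique fs fm fe gs gm ge).
split; last exact: (t1_antisym hk1 T1_add T1_scale T1_quad).
  have [e1 [e2 ->]] := symmetrize_span; exists e1, (e2 - (1 + k1^-1 * k1^-1)).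
  by rewrite (rmorphB (@cst R)) /= mulrBl addrA.
apply/monic_low; rewrite addrAC; apply: lspanB; first exact/monic_low/sym_monic.
by apply: lspanZ; exact: nonsymAWN_low.
Qed.

Local Notation Ysym := (ysym (@cst R) k0 k1 t0 t1).

(** (Y - ga) h is a multiple of P_(-M) and (Y - ga^-1) h one of P_M; their difference is a nonzero
    multiple of [h]. *)
Lemma ysym_in_span K h : low K h ->
  Ysym h = cst (ga M + (ga M)^-1) * h -> in_span_pm q s k0 k1 u0 u1 M h.
Proof.
move=> Kh hE.
have split_ := ysym_split T0_add T1_add T0_scale T1_scale T0_quad T1_quad.
have YK : low K (t1 (t0 h)) := triangular_stable Y_add Y_scale Y_triangular Kh.
have e1 := split_ _ _ gM0 hE.
have e2 := split_ (ga M)^-1 h (invr_neq0 gM0).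
rewrite invrK addrC in e2; have {}e2 := e2 hE.
rewrite -gammaN in e1.
have [c1 h1] := eigen_nonsymAW (lspanB YK (lspanZ _ Kh)) e1.
have [c2 h2] := eigen_nonsymAW (lspanB YK (lspanZ _ Kh)) e2.
exists (c2 / (ga M - (ga M)^-1)), (- (c1 / (ga M - (ga M)^-1))).
have : cst (ga M - (ga M)^-1) * h = cst c2 * P M%:Z - cst c1 * N.
  by rewrite -h1 -h2 rmorphB /=; move: (t1 (t0 h)) => y; ring.
move=> /(canRL (mulKf (cst_neq0 gap))) ->.
by rewrite rmorphN !(rmorphM (@cst R)) fmorphV /=; move: (P _) N => f g; ring.
Qed.

End Pair.
End AskeyWilsonPolynomials.

(** * The parameter shift *)

(* (1 - c/y) (1 - d/y) y for c = s k u and d = - s k / u. *)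
Definition wt (F : fieldType) (s k u y : F) : F :=
  (1 - s * k * u * y^-1) * (1 + s * k * u^-1 * y^-1) * y.

Lemma rmorph_wt (F K : fieldType) (phi : {rmorphism F -> K}) s k u y :
  phi (wt s k u y) = wt (phi s) (phi k) (phi u) (phi y).
Proof. by rewrite /wt !(rmorphD, rmorphN, rmorphM, fmorphV, rmorph1). Qed.

(** Multiplication by w carries functions invariant under the reflection of T0 into its
    (-k^-1)-eigenspace. *)
Lemma dl_anti (F : fieldType) (s k u y h : F) :
  s != 0 -> k != 0 -> u != 0 -> y != 0 -> y ^+ 2 - s ^+ 2 != 0 ->
  dl k u (s / y) (wt s k u y * h) (wt s k u (s ^+ 2 / y) * h)
  = - k^-1 * (wt s k u y * h).
Proof.
move=> s0 k0 u0 y0 ys; rewrite /dl /wt; field.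
by rewrite s0 k0 u0 y0 ys.
Qed.

(* The conjugation of Y + Y^-1 by w, written on the values h, hp, hm of H at s y,
   1/(s y) and y/s: G1 and G2 are the values of T1^-1 (w H) at s y and s/y, while
   t and t' are those of T0 H(s .) for the shifted parameters at y and 1/y. *)
Lemma dl_shift (F : fieldType) (s k0 k1 u0 u1 y h hp hm : F)
    (w := wt s k0 u0)
    (G := fun z f g => dl k1 u1 z f g - (k1 - k1^-1) * f)
    (G1 := G (s * y) (w (s * y) * h) (w (s * y)^-1 * hp))
    (G2 := G (s / y) (w (s / y) * h) (w (y / s) * hm))
    (t := dl (s * k0) u0 (s / y) h hm)
    (t' := dl (s * k0) u0 (s * y) h hp) :
  s != 0 -> k0 != 0 -> k1 != 0 -> u0 != 0 -> u1 != 0 -> y != 0 ->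
  1 - y ^+ 2 != 0 -> 1 - s ^+ 2 * y ^+ 2 != 0 -> y ^+ 2 - s ^+ 2 != 0 ->
  - k0^-1 * (G1 + (k1 - k1^-1) * (w (s * y) * h))
    + (dl k0 u0 y^-1 G1 G2 - (k0 - k0^-1) * G1)
  = w (s * y) * (dl (s * k1) u1 y t t'
      + (s * k1)^-1 * (t - (s * k0 - (s * k0)^-1) * h)).
Proof.
move=> s0 k00 k10 u00 u10 y0 y1 y2 y3.
rewrite /t' /t /G2 /G1 /G /w /dl /wt; field.
rewrite s0 k00 k10 u00 u10 y0 y3 y1 oner_neq0 exprMn y2.
by rewrite -opprB oppr_eq0 y1.
Qed.

Section Shift.
Variable R : realType.
Local Notation C := (complex R).
Local Notation Cx := {fraction {poly (complex R)}}.
Local Notation x := (xx R).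
Implicit Types (f g h : Cx) (c e : C).

Variables (q s k0 k1 u0 u1 : C).
Hypotheses (hq0 : q != 0) (hs : s ^+ 2 = q).
Hypotheses (hk0 : k0 != 0) (hk1 : k1 != 0) (hu0 : u0 != 0) (hu1 : u1 != 0).

Let s0 : s != 0 := sqrt_neq0 hq0 hs.
Let nc c (c0 : c != 0) : nonconst (cst c * x) := cstM_nonconst c0 (xx_nonconst R).
Let ncV c (c0 : c != 0) : nonconst (cst c * x^-1) := cstV_nonconst c0.
Let cst0 c (c0 : c != 0) : cst c != 0 :> Cx := cst_neq0 c0.

Lemma subst_cstX c p : nonconst p -> subst (cst c * x) p = cst c * p.
Proof. by move=> np; rewrite (substM np) (subst_cst np) (subst_xx np). Qed.

Lemma subst_cstXV c p : nonconst p -> subst (cst c * x^-1) p = cst c * p^-1.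
Proof.
by move=> np; rewrite (substM np) (subst_cst np) (substV np) (subst_xx np).
Qed.

Lemma mul_cst c e f : cst c * (cst e * f) = cst (c * e) * f.
Proof. by rewrite mulrA -rmorphM. Qed.

Lemma inv_cstX c : (cst c * x)^-1 = cst c^-1 * x^-1.
Proof. by rewrite invfM fmorphV. Qed.

Lemma inv_cstXV c : (cst c * x^-1)^-1 = cst c^-1 * x.
Proof. by rewrite invfM invrK fmorphV. Qed.

Local Notation t1 := (T1 k1 u1).
Local Notation t0 := (T0 q s k0 u0).
Local Notation t1' := (T1 (s * k1) u1).
Local Notation t0' := (T0 q s (s * k0) u0).
Local Notation w := (wt (cst s) (cst k0) (cst u0)).

Lemma subst_wt f p : nonconst p -> subst (w f) p = w (subst f p).
Proof.
by move=> np; rewrite -[LHS]/(substm np _) rmorph_wt /= /substm !(subst_cst np).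
Qed.

Lemma subst_dl k u y f g p : nonconst p ->
  subst (dl (cst k) (cst u) y f g) p
  = dl (cst k) (cst u) (subst y p) (subst f p) (subst g p).
Proof.
by move=> np; rewrite -[LHS]/(substm np _) rmorph_dl /= /substm !(subst_cst np).
Qed.

Lemma T0_point f :
  t0 f = dl (cst k0) (cst u0) (cst s * x^-1) f (subst f (cst q * x^-1)).
Proof. exact: T0E. Qed.

Lemma T1_point f : t1 f = dl (cst k1) (cst u1) x f (subst f x^-1).
Proof. exact: T1E. Qed.

Variable H : Cx.
Hypothesis Hq : subst H (cst q * x^-1) = H.

Let q_sV : q * s^-1 = s. Proof. by rewrite -hs expr2 mulfK. Qed.

Let H_inv c : c != 0 -> subst H (cst c * x^-1) = subst H (cst (q / c) * x).
Proof.
move=> c0; rewrite -{1}Hq (subst_comp (ncV c0)); last exact: ncV.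
by rewrite (subst_cstXV _ (ncV c0)) inv_cstXV mul_cst.
Qed.

Let Ht := subst H (cst s * x).

(** Rescaling by s turns the symmetry x -> q/x of [H] into x -> 1/x. *)
Let Ht_sym : subst Ht x^-1 = Ht.
Proof.
rewrite /Ht (subst_comp (xV_nonconst R) _ (nc s0)).
by rewrite (subst_cstX _ (xV_nonconst R)) H_inv // q_sV.
Qed.

Local Notation F := (w x * H).
Local Notation hp := (subst H (cst (q * s) * x)).
Local Notation hm := (subst H (cst s^-1 * x)).

Let F_point p : nonconst p -> subst F p = w p * subst H p.
Proof. by move=> np; rewrite (substM np) subst_wt // (subst_xx np). Qed.

Let sV0 : s^-1 != 0. Proof. by rewrite invr_eq0. Qed.
Lemma T0_wt : t0 F = cst (- k0^-1) * F.
Proof.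
rewrite T0_point F_point ?Hq; last exact: ncV.
have sq : cst q = cst s ^+ 2 by rewrite -hs (rmorphXn (@cst R)).
rewrite [cst q]sq (rmorphN (@cst R)) fmorphV.
apply: (dl_anti _ (cst0 s0) (cst0 hk0) (cst0 hu0) (xx_neq0 R)).
by rewrite -sq subr_eq0; apply/nonconstP/nonconstX2/xx_nonconst.
Qed.

Let Ht_q : subst Ht (cst q * x^-1) = hm.
Proof.
rewrite /Ht (subst_comp (ncV hq0) _ (nc s0)) (subst_cstX _ (ncV hq0)) mul_cst.
rewrite H_inv ?mulf_neq0 //.
by congr (subst H (cst _ * x)); rewrite invfM mulrCA divff // mulr1.
Qed.

Let hm_V : subst hm x^-1 = hp.
Proof.
rewrite (subst_comp (xV_nonconst R) _ (nc sV0)) (subst_cstX _ (xV_nonconst R)).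
by rewrite H_inv // invrK.
Qed.

Lemma T1_at f p : nonconst p -> subst (t1 f) p
  = dl (cst k1) (cst u1) p (subst f p) (subst f p^-1).
Proof.
move=> np; rewrite T1_point (subst_dl _ _ _ _ _ np) (subst_xx np).
by rewrite (subst_comp np _ (xV_nonconst R)) (substV np) (subst_xx np).
Qed.

Lemma T0_at f p : nonconst p -> subst (t0 f) p
  = dl (cst k0) (cst u0) (cst s * p^-1) (subst f p) (subst f (cst q * p^-1)).
Proof.
move=> np; rewrite T0_point (subst_dl _ _ _ _ _ np) (subst_cstXV _ np).
by rewrite (subst_comp np _ (ncV hq0)) (subst_cstXV _ np).
Qed.

Lemma ysym_shift :
  subst (ysym (@cst R) k0 k1 t0 t1 (w x * H)) (cst s * x)
  = w (cst s * x) * ysym (@cst R) (s * k0) (s * k1) t0' t1' Ht.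
Proof.
have T1Ht : t1' Ht = cst (s * k1) * Ht by rewrite T1E hecke_sym.
have T0Ht : t0' Ht = dl (cst s * cst k0) (cst u0) (cst s / x) Ht hm.
  by rewrite (T0E _ _ hs) /hecke Ht_q rmorphM.
have T0HtV : subst (t0' Ht) x^-1 = dl (cst s * cst k0) (cst u0) (cst s * x) Ht hp.
  rewrite T0Ht -rmorphM (subst_dl _ _ _ _ _ (xV_nonconst R)) Ht_sym hm_V.
  by rewrite (subst_cstXV _ (xV_nonconst R)) invrK.
(* On the symmetric [Ht] the inverse of the shifted T1 is the scalar (s k1)^-1, so only the shifted
   T0 has to be evaluated. *)
have -> : ysym (@cst R) (s * k0) (s * k1) t0' t1' Ht
  = dl (cst s * cst k1) (cst u1) x (t0' Ht) (subst (t0' Ht) x^-1)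
    + (cst s * cst k1)^-1 * (t0' Ht - (cst s * cst k0 - (cst s * cst k0)^-1) * Ht).
  rewrite /ysym T1Ht; congr (_ + _); first by rewrite T1E /hecke rmorphM.
  rewrite -mulrBl -rmorphB opprB addrCA subrr addr0 (T0Z _ _ hq0 hs).
  by rewrite !(rmorphB, rmorphM, fmorphV) /=; move: (t0' Ht) => f; ring.
rewrite T0HtV T0Ht.
have cstVB c : cst (c - c^-1) = cst c - (cst c)^-1 :> Cx.
  by rewrite rmorphB fmorphV.
have sxV : (cst s * x)^-1 = cst s^-1 * x^-1 := inv_cstX s.
have F1 : subst F (cst s * x) = w (cst s * x) * Ht := F_point (nc s0).
have F2 : subst F (cst s * x)^-1 = w (cst s * x)^-1 * hp.
  by rewrite sxV (F_point (ncV sV0)) (H_inv sV0) invrK.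
have F3 : subst F (cst s * x^-1) = w (cst s * x^-1) * Ht.
  by rewrite (F_point (ncV s0)) (H_inv s0) q_sV.
have F4 : subst F (cst s * x^-1)^-1 = w (x / cst s) * hm.
  rewrite inv_cstXV (F_point (nc sV0)).
  by rewrite fmorphV [x / _]mulrC.
have np := nc s0.
(* [G] is T1^-1 F. Applying T0 to it at s x requires its values at s x and s/x, hence those of F at
   these two points and their inverses. *)
pose G := t1 F - cst (k1 - k1^-1) * F.
have G_point p : nonconst p -> subst G p
    = dl (cst k1) (cst u1) p (subst F p) (subst F p^-1)
      - (cst k1 - (cst k1)^-1) * subst F p.
  move=> pc; rewrite (substD pc) (substN pc) (substM pc) (subst_cst pc) cstVB.
  by rewrite T1_at.
have G1 := G_point _ np; have G2 := G_point _ (ncV s0).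
rewrite F1 F2 in G1; rewrite F3 F4 in G2.
rewrite /ysym T0_wt T1Z -/G.
have lin a b f g h : subst (cst a * f + (g - cst b * h)) (cst s * x)
    = cst a * subst f (cst s * x) + (subst g (cst s * x) - cst b * subst h (cst s * x)).
  by rewrite (substD np) (substD np) (substN np) !(substM np) !(subst_cst np).
have t1G : t1 F = G + cst (k1 - k1^-1) * F by rewrite /G subrK.
rewrite t1G lin (substD np) (substM np) (subst_cst np) T0_at //.
have -> : cst s * (cst s * x)^-1 = x^-1.
  by rewrite sxV mul_cst divff // rmorph1 mul1r.
have -> : cst q * (cst s * x)^-1 = cst s * x^-1.
  by rewrite sxV mul_cst q_sV.
rewrite G1 G2 F1 !cstVB rmorphN fmorphV.
have x2 : x ^+ 2 != 1.
  by rewrite -(rmorph1 (@cst R)); apply/nonconstP/nonconstX2/xx_nonconst.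
apply: (dl_shift _ _ _ (cst0 s0) (cst0 hk0) (cst0 hk1) (cst0 hu0) (cst0 hu1) (xx_neq0 R)).
- by rewrite subr_eq0 eq_sym.
- rewrite subr_eq0 eq_sym -exprMn -(rmorph1 (@cst R)).
  exact/nonconstP/nonconstX2.
- by rewrite -(rmorphXn (@cst R)) subr_eq0; apply/nonconstP/nonconstX2/xx_nonconst.
Qed.

End Shift.

(** * Uniqueness of the symmetric polynomials, with degree zero included *)

Lemma monic_at0 (R : realType) (f : {fraction {poly (complex R)}}) :
  monic_at 0 f <-> f = 1.
Proof.
split=> [/monic_low/low0/eqP|->]; first by rewrite expr0z subr_eq0 => /eqP.
by apply/monic_low; rewrite expr0z subrr; exact: lspan0.
Qed.

Section SymUnique.
Variables (R : realType) (q s k0 k1 u0 u1 : complex R).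
Hypotheses (hq0 : q != 0) (hs : s ^+ 2 = q).
Hypotheses (hk0 : k0 != 0) (hk1 : k1 != 0) (hu0 : u0 != 0) (hu1 : u1 != 0).
Hypothesis hq : forall j : nat, (0 < j)%N -> q ^+ j != 1.
Hypothesis hk : forall j : nat, (0 < j)%N -> k0 ^+ 2 * k1 ^+ 2 * q ^+ j != 1.

Lemma symAW_unique m f : is_symAW q s k0 k1 u0 u1 m f -> symAW q s k0 k1 u0 u1 m = f.
Proof.
move=> fS; apply: xget_subset1 fS _ => {f} g h [gs gm ge] [hs' hm he].
case: m gs gm hs' hm => [|m] gs gm hs' hm.
  by rewrite ((monic_at0 g).1 gm) ((monic_at0 h).1 hm).
exact: (in_span_eigen_unique hq0 hs hk0 hk1 hu0 hu1 hq hk gs gm ge hs' hm he).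
Qed.

Lemma symAW0 : symAW q s k0 k1 u0 u1 0 = 1.
Proof.
apply: symAW_unique; split.
- exists 1, 0; rewrite (nonsymAW0 hq0 hs hk0 hk1 hu0 hu1 hq hk) rmorph1 rmorph0.
  by rewrite mul0r addr0 mul1r.
- exact/monic_at0.
by rewrite T1E hecke_sym // (subst1 (xV_nonconst R)).
Qed.

End SymUnique.

(** * Divided differences *)

Lemma dl_difference (F : fieldType) (s k u y f g : F) (q := s ^+ 2) :
  s != 0 -> k != 0 -> u != 0 -> y != 0 -> y ^+ 2 - q != 0 ->
  wt s k u y * ((g - f) / (y - q / y)) = k * (dl k u (s / y) f g - k * f).
Proof.
(* Since 1 - q/y^2 = (y - q/y)/y, the last factor y of [wt] accounts for the change of
   denominator. *)
move=> s0 k0 u0 y0 ys; rewrite /dl /wt /q in ys *; field.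
by rewrite ?s0 k0 u0 y0 ys.
Qed.

Section Difference.
Variable R : realType.
Local Notation Cx := {fraction {poly (complex R)}}.
Local Notation x := (xx R).
Variable s : complex R.
Hypothesis s0 : s != 0.

(** The quotient (f(q/z) - f(z)) / (z - q/z) at z = s x with q = s^2, where the reflection z -> q/z
    reads x -> 1/x. *)
Definition sdiff (f : Cx) : Cx :=
  (subst f (cst s * x^-1) - subst f (cst s * x)) / (cst s * x - cst s * x^-1).

Let nc : nonconst (cst s * x) := cstM_nonconst s0 (xx_nonconst R).
Let ncV : nonconst (cst s * x^-1) := cstV_nonconst s0.

Lemma sdiffD : {morph sdiff : f g / f + g}.
Proof.
by move=> f g; rewrite /sdiff (substD nc) (substD ncV) -mulrDl opprD addrACA.
Qed.

Lemma sdiffZ c f : sdiff (cst c * f) = cst c * sdiff f.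
Proof.
rewrite /sdiff (substM nc) (substM ncV) (subst_cst nc) (subst_cst ncV).
by rewrite -mulrBr mulrA.
Qed.

Let chebU_quot (F : fieldType) (y : F) j : y != 0 -> y ^+ 2 != 1 ->
  (y ^- j - y ^+ j) / (y - y^-1) = - chebU y j.
Proof.
move=> y0 y2; rewrite -opprB -chebU_geom // mulNr mulrC mulKf //.
by rewrite subr_eq0; apply: contra y2 => /eqP e; rewrite expr2 {1}e mulVf.
Qed.

Let x2 : x ^+ 2 != 1.
Proof.
by rewrite -(rmorph1 (@cst R)); apply/nonconstP/nonconstX2/xx_nonconst.
Qed.

Let sdiffXz n : sdiff (x ^ n) =
  cst (s ^ n * s^-1) * ((x ^ (- n) - x ^ n) / (x - x^-1)).
Proof.
rewrite /sdiff (substXz nc) (substXz ncV) (subst_xx nc) (subst_xx ncV).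
rewrite !expfzMl exprz_inv -!mulrBr invfM mulrACA.
by rewrite -(fmorphXz (@cst R)) -fmorphV -(rmorphM (@cst R)).
Qed.

Lemma sdiff_pow (j : nat) :
  sdiff (x ^ j%:Z) = cst (- (s ^ j%:Z * s^-1)) * chebU x j.
Proof.
rewrite sdiffXz -exprnN -exprnP (chebU_quot j (xx_neq0 R) x2).
by rewrite mulrN -mulNr -rmorphN.
Qed.

Lemma sdiff_powV (j : nat) :
  sdiff (x ^ (- j%:Z)) = cst (s ^ (- j%:Z) * s^-1) * chebU x j.
Proof.
rewrite sdiffXz opprK -[x ^ (- _)]exprnN -exprnP -[x ^+ j - _]opprB mulNr.
by rewrite (chebU_quot j (xx_neq0 R) x2) opprK.
Qed.

Lemma sdiff_inner m f : inner m.+1 f -> inner m (sdiff f).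
Proof.
elim=> [|c n h nm _ IH].
  rewrite /sdiff (subst0 nc) (subst0 ncV) subrr mul0r; exact: lspan0.
rewrite sdiffD sdiffZ; apply: lspanD => //; apply: lspanZ.
have cheb j : inner j (chebU x j).
  by apply: (chebU_inner (xx_nonconst R)) => l i il; apply: lspanX.
case: n nm => j jm; rewrite ?NegzE ?sdiff_pow ?sdiff_powV; apply: lspanZ.
  by apply: innerS (cheb j); exact: jm.
by apply: innerS (cheb j.+1); exact: jm.
Qed.

End Difference.

(** * The divided difference of [P_(-M)] as a shifted symmetric polynomial *)

Section Decomposition.
Variable R : realType.
Local Notation C := (complex R).
Local Notation Cx := {fraction {poly (complex R)}}.
Local Notation x := (xx R).

Variables (q s k0 k1 u0 u1 : C).
Hypotheses (hq0 : q != 0) (hs : s ^+ 2 = q).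
Hypotheses (hk0 : k0 != 0) (hk1 : k1 != 0) (hu0 : u0 != 0) (hu1 : u1 != 0).
Hypothesis hq : forall j : nat, (0 < j)%N -> q ^+ j != 1.
Hypothesis hk : forall j : nat, (0 < j)%N -> k0 ^+ 2 * k1 ^+ 2 * q ^+ j != 1.

Variable m : nat.
Local Notation M := (m.+1).
Local Notation t1 := (T1 k1 u1).
Local Notation t0 := (T0 q s k0 u0).
Local Notation N := (nonsymAW q s k0 k1 u0 u1 (- M%:Z)).
Local Notation E := (symAW q s k0 k1 u0 u1 M).
Local Notation w := (wt (cst s) (cst k0) (cst u0) x).
Local Notation ga := (gamma q k0 k1 M%:Z).

Let s0 : s != 0 := sqrt_neq0 hq0 hs.
Let nc c (c0 : c != 0) : nonconst (cst c * x) := cstM_nonconst c0 (xx_nonconst R).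
Let ncV c (c0 : c != 0) : nonconst (cst c * x^-1) := cstV_nonconst c0.

Let wt_neq0 p : nonconst p -> wt (cst s) (cst k0) (cst u0) p != 0.
Proof.
move=> np; have one_sub c : c != 0 -> 1 - cst c * p^-1 != 0.
  move=> c0; have := nonconstP 1 (cstM_nonconst c0 (nonconstV np)).
  by rewrite rmorph1 subr_eq0 eq_sym.
have p0 : p != 0 by have := nonconstP 0 np; rewrite rmorph0.
apply: mulf_neq0 p0; apply: mulf_neq0.
  by rewrite -!rmorphM; apply: one_sub; rewrite !mulf_neq0.
rewrite -fmorphV -!rmorphM -[cst _ * p^-1]opprK -mulNr -rmorphN.
by apply: one_sub; rewrite oppr_eq0 !mulf_neq0 ?invr_eq0.
Qed.

(** The factor q^M gives [E] the coefficient 1 in w H and makes s^m the leading coefficient of H(s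
    x). *)
Definition reflect_diff : Cx :=
  cst (q ^+ M) * ((subst N (cst q * x^-1) - N) / (x - cst q * x^-1)).
Local Notation H := reflect_diff.

Lemma reflect_diff_sym : subst H (cst q * x^-1) = H.
Proof.
have np := ncV hq0.
rewrite /H (substM np) (subst_cst np) (substM np) (substV np).
rewrite !(substD np) !(substN np) (subst_xx np) (subst_cstXV _ np).
rewrite (subst_comp np _ np) (subst_cstXV _ np) inv_cstXV mul_cst divff //.
rewrite rmorph1 mul1r subst_id; congr (_ * _).
by rewrite -opprB -[_ - x]opprB invrN mulrNN.
Qed.

Lemma wt_reflect_diff : w * H = cst (k0 * q ^+ M) * (t0 N - cst k0 * N).
Proof.
rewrite T0_point // /H mulrCA.
have sq : cst q = cst s ^+ 2 by rewrite -hs (rmorphXn (@cst R)).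
rewrite [in x - _]sq dl_difference; try exact: cst_neq0.
- by rewrite mulrA -rmorphM [q ^+ _ * _]mulrC.
- exact: xx_neq0.
by rewrite -sq subr_eq0; apply/nonconstP/nonconstX2/xx_nonconst.
Qed.

Let T0_add := T0D k0 u0 hq0 hs.
Let T1_add := T1D k1 u1.
Let T0_scale := T0Z k0 u0 hq0 hs.
Let T1_scale := T1Z k1 u1.
Let T0_quad := T0_quadratic hq0 hs hk0 hu0.
Let T1_quad := T1_quadratic hk1 hu1.
Let gM0 : ga != 0 := gamma_neq0 hq0 hk0 hk1 M%:Z.

Let YN := Y_nonsymAWN hq0 hs hk0 hk1 hu0 hu1 hq hk m.

Let EE := symAW_E hq0 hs hk0 hk1 hu0 hu1 hq hk m.

(** (T0 - k0) N is computed twice: as a multiple of w H, and from [t0_N] in terms of E and N. *)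
Lemma nonsymAWN_decomposition :
  cst (1 + k0 ^+ 2 * q ^+ M) * N = E - w * H.
Proof.
rewrite wt_reflect_diff (t0_N hk1 T1_scale T1_quad gM0 YN) -EE.
have -> : ga^-1 * k1 = (k0 * q ^+ M)^-1.
  by rewrite gamma_nat !invfM mulrAC mulrVK // unitfE.
have : k0 * q ^+ M != 0 by rewrite mulf_neq0 ?expf_neq0.
have -> : 1 + k0 ^+ 2 * q ^+ M = 1 + k0 * q ^+ M * k0 by ring.
move: (k0 * _) => c c0; rewrite mulrBr mul_cst divff // mul_cst.
by rewrite !rmorphD !rmorph1; move: E N => e n; ring.
Qed.

(** w H lies in the span of E and N, on which Y + Y^-1 is a scalar. *)
Lemma ysym_reflect_diff :
  ysym (@cst R) k0 k1 t0 t1 (w * H) = cst (ga + ga^-1) * (w * H).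
Proof.
have -> : w * H = E + cst (- (1 + k0 ^+ 2 * q ^+ M)) * N.
  by rewrite rmorphN mulNr nonsymAWN_decomposition opprB addrC subrK.
rewrite (ysymD k0 k1 T0_add T1_add T0_scale) (ysymZ k0 k1 T0_add T0_scale T1_scale).
rewrite (ysym_N hk0 hk1 T0_add T0_scale T1_scale T0_quad T1_quad gM0 YN) {1}EE.
rewrite (ysym_sym hk0 hk1 T0_add T1_add T0_scale T1_scale T0_quad T1_quad gM0 YN) -EE.
by rewrite mulrDr [X in _ + X]mulrCA.
Qed.

Local Notation Ht := (subst H (cst s * x)).

Lemma reflect_diff_sdiff : Ht = cst (q ^+ M) * sdiff s N.
Proof.
have np := nc s0.
rewrite (substM np) (subst_cst np) (substM np) (substV np).
rewrite !(substD np) !(substN np) (subst_xx np) (subst_cstXV _ np).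
rewrite (subst_comp np _ (ncV hq0)) (subst_cstXV _ np) inv_cstX mul_cst.
by rewrite (_ : q / s = s) // -hs expr2 mulfK.
Qed.

Lemma reflect_diff_monic : monic_at m (cst (s ^- m) * Ht).
Proof.
rewrite reflect_diff_sdiff mul_cst.
have Ni := nonsymAWN_inner hq0 hs hk0 hk1 hu0 hu1 hq hk m.
(* Only the leading monomial matters: the divided difference sends the rest of [N] into
   [inner m]. *)
have -> : N = x ^ (- M%:Z) + (N - x ^ (- M%:Z)) by rewrite addrC subrK.
rewrite (sdiffD s0) mulrDr (sdiff_powV s0) mul_cst.
have -> : s ^- m * q ^+ M * (s ^ (- M%:Z) * s^-1) = 1.
  have -> : q ^+ M = s ^+ m * (s ^+ M * s).
    by rewrite -hs -exprM -exprSr -exprD; congr (s ^+ _); lia.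
  by rewrite -exprnN mulKf ?expf_neq0 // -invfM mulfV ?mulf_neq0 ?expf_neq0.
rewrite rmorph1 mul1r; set r := _ * sdiff s _.
have ri : inner m r by apply/lspanZ/(sdiff_inner s0).
have inner_rank f : inner m f -> low (rank m%:Z) f.
  by move/inner_low; apply: le_low; rewrite /rank /=; lia.
apply/monic_low; rewrite addrAC; apply: lspanD; last exact: inner_rank.
case: (m) => [|l]; first by rewrite /= mulr0 addr0 subrr; exact: lspan0.
rewrite (chebUSS (xx_neq0 R)) addrAC subrr add0r exprnN; apply: lspanD.
  have li : inner l (chebU x l).
    by apply: (chebU_inner (xx_nonconst R)) => j i il; apply: lspanX.
  by move/inner_low: li; apply: le_low; rewrite /rank /=; lia.
by apply: lspanX; rewrite /rank /=; lia.
Qed.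

Let hk0' : s * k0 != 0. Proof. exact: mulf_neq0. Qed.
Let hk1' : s * k1 != 0. Proof. exact: mulf_neq0. Qed.
Let hk' (j : nat) : (0 < j)%N -> (s * k0) ^+ 2 * (s * k1) ^+ 2 * q ^+ j != 1.
Proof.
(* The shift multiplies k0^2 k1^2 by q^2, moving the exponent from j to j + 2. *)
move=> _; have := hk (j := j.+2) isT.
by rewrite !exprMn hs !exprS; congr (_ != _); ring.
Qed.

Lemma symAW_shift : subst (symAW q s (s * k0) (s * k1) u0 u1 m) (cst s^-1 * x)
  = cst (s ^- m) * H.
Proof.
have s1 : s^-1 != 0 by rewrite invr_eq0.
(* By uniqueness it is enough that s^-m H(s x) has the defining properties for the shifted
   parameters; substituting x/s then returns to [H]. *)
suff hS : is_symAW q s (s * k0) (s * k1) u0 u1 m (cst (s ^- m) * Ht).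
  rewrite (symAW_unique hq0 hs hk0' hk1' hu0 hu1 hq hk' hS).
  have np := nc s1; rewrite (substM np) (subst_cst np) (subst_comp np _ (nc s0)).
  by rewrite (subst_cstX _ np) mul_cst divff // rmorph1 mul1r subst_id.
have hm := reflect_diff_monic.
have hT1 : T1 (s * k1) u1 Ht = cst (s * k1) * Ht.
  rewrite T1E hecke_sym // (subst_comp (xV_nonconst R) _ (nc s0)).
  rewrite (subst_cstX _ (xV_nonconst R)) -[in LHS]reflect_diff_sym.
  rewrite (subst_comp (ncV s0) _ (ncV hq0)) (subst_cstXV _ (ncV s0)) inv_cstXV mul_cst.
  by rewrite (_ : q / s = s) // -hs expr2 mulfK.
split=> //; last by rewrite T1Z hT1 mulrCA.
case: (posnP m) => [m0|mp].
  have P0 := nonsymAW0 hq0 hs hk0' hk1' hu0 hu1 hq hk'.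
  move: hm; rewrite m0 => /monic_at0 ->; exists 1, 0.
  by rewrite P0 rmorph1 rmorph0 mul0r addr0 mul1r.
have [l ml] : exists l, m = l.+1 by exists m.-1; rewrite prednK.
have Hlow : low (rank m%:Z).+1 (cst (s ^- m) * Ht).
  move/monic_low: hm => hm; rewrite -[X in low _ X](subrK (x ^ m%:Z)).
  by apply: lspanD; [apply: le_low hm|apply: lspanX].
(* The nonzero factor w(s x) is cancelled in [ysym_shift]. *)
have yH : ysym (@cst R) (s * k0) (s * k1) (T0 q s (s * k0) u0) (T1 (s * k1) u1) Ht
    = cst (ga + ga^-1) * Ht.
  have := ysym_shift hq0 hs hk0 hk1 hu0 hu1 reflect_diff_sym.
  rewrite ysym_reflect_diff (substM (nc s0)) (subst_cst (nc s0)) (substM (nc s0)).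
  rewrite subst_wt ?(subst_xx (nc s0)); last exact: nc.
  by rewrite mulrCA => /(mulfI (wt_neq0 (nc s0)))/esym.
(* As s^2 = q, raising the index by one has the same effect as the parameter shift. *)
have gaE : ga = gamma q (s * k0) (s * k1) m%:Z.
  by rewrite !gamma_nat exprS -hs expr2; ring.
move: hm Hlow gaE yH; rewrite ml => hm Hlow gaE yH.
apply: (ysym_in_span hq0 hs hk0' hk1' hu0 hu1 hq hk' Hlow).
rewrite (ysymZ _ _ (T0D _ _ hq0 hs) (T0Z _ _ hq0 hs) (T1Z _ _)) -gaE [RHS]mulrCA.
by rewrite yH.
Qed.

End Decomposition.

(** * Identities between the coefficients *)

Section Coefficients.
Variables (F : fieldType) (k0 k1 Q : F).
Hypotheses (hk0 : k0 != 0) (hk1 : k1 != 0) (hQ : Q != 0).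
Hypothesis hD : 1 + k0 ^+ 2 * Q != 0.

(** Here [Q] is q^m and [g] is gamma_m. The factor 1 + k0^2 Q = 1 - cd q^(m-1) is split off to
    cancel the denominator of [P_(-m)]. *)
Lemma nonsym_coefE (g := k0 * k1 * Q) (G := 1 - k0 ^+ 2 * k1 ^+ 2 * Q ^+ 2) :
  G != 0 ->
  ((k0 - k0^-1) / k1 + g^-1 - g / (k1 * k1)) / (g - g^-1)
  = - ((1 - Q) / G) * (1 + k0 ^+ 2 * Q).
Proof.
rewrite /g /G => G0; field.
have G0' : 1 - (k0 * k1 * Q) ^+ 2 != 0 by rewrite !exprMn.
by rewrite hk0 hk1 hQ G0' -expr2 -opprB oppr_eq0 G0'.
Qed.

Lemma nonsym_coefE' (G := 1 - k0 ^+ 2 * k1 ^+ 2 * Q ^+ 2) : G != 0 ->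
  Q * ((1 - k0 ^+ 2 * k1 ^+ 2 * Q) / G) = 1 - (1 - Q) / G.
Proof.
move=> G0; have -> : 1 - (1 - Q) / G = (G - (1 - Q)) / G by rewrite [RHS]mulrBl divff.
by rewrite mulrA; congr (_ / _); rewrite /G; ring.
Qed.

Lemma antisym_coefE :
  1 - (1 + k1^-1 * k1^-1) / (1 + k0 ^+ 2 * Q)
  = (1 - k0 ^+ 2 * k1 ^+ 2 * Q) / (- k1 ^+ 2 * (1 + k0 ^+ 2 * Q)).
Proof.
by field; rewrite hD hk1 oppr_eq0 expf_neq0.
Qed.

Lemma antisym_coefE' :
  (1 + k1^-1 * k1^-1) / (1 + k0 ^+ 2 * Q)
  = (- k1 ^+ 2 - 1) / (- k1 ^+ 2 * (1 + k0 ^+ 2 * Q)).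
Proof.
by field; rewrite hD hk1 oppr_eq0 expf_neq0.
Qed.

End Coefficients.

(** * The three expansions *)

Theorem proposition5p10 (R : realType) (q s k0 k1 u0 u1 : complex R)
  (hq0 : q != 0) (hq1 : `|q| != 1) (hs : s ^+ 2 = q)
  (hk0 : k0 != 0) (hk1 : k1 != 0) (hu0 : u0 != 0) (hu1 : u1 != 0)
  (gk0 : not_pm_qpow q (k0 ^+ 2)) (gk1 : not_pm_qpow q (k1 ^+ 2))
  (gu1 : not_pm_qpow q (u1 ^+ 2))
  (* the eigenvalues gamma_m are pairwise distinct, i.e. all P_m are
     well defined *)
  (ggamma : forall j : nat, (0 < j)%N -> k0 ^+ 2 * k1 ^+ 2 * q ^+ j != 1) :
  let a := AWa k1 u1 in
  let b := AWb k1 u1 in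
  let c := AWc s k0 u0 in
  let d := AWd s k0 u0 in
  let x := xx R in
  let P := nonsymAW q s k0 k1 u0 u1 in
  let Pplus := symAW q s k0 k1 u0 u1 in
  let Pminus := antisymAW q s k0 k1 u0 u1 in
  (* P_n^+(q^{-1/2} x; q^{1/2} a, q^{1/2} b, q^{1/2} c, q^{1/2} d) *)
  let Qplus (n : nat) :=
    subst (symAW q s (s * k0) (s * k1) u0 u1 n) (cst s^-1 * x) in
  let w := (1 - cst c * x^-1) * (1 - cst d * x^-1) * x in
  [/\ (* for m > 0 the denominator is never zero; for m = 0 the condition
         excludes the case where the first coefficient reads 0/0 *)
      forall m : nat,
        1 - a * b * c * d * q ^ (2 * m%:Z - 1) != 0 ->
        P m%:Z =
          cst (q ^+ m * ((1 - a * b * c * d * q ^ (m%:Z - 1))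
                         / (1 - a * b * c * d * q ^ (2 * m%:Z - 1))))
            * Pplus m
          + (if m == 0%N then 0 else
             cst (s ^+ m.-1) * w
               * cst ((1 - q ^+ m)
                      / (1 - a * b * c * d * q ^ (2 * m%:Z - 1)))
               * Qplus m.-1),
      forall m : nat, (0 < m)%N ->
        P (- m%:Z) =
          cst (1 / (1 - c * d * q ^+ m.-1)) * Pplus m
          - cst (s ^+ m.-1) * w * cst (1 / (1 - c * d * q ^+ m.-1))
              * Qplus m.-1
    & forall m : nat, (0 < m)%N ->
        Pminus m =
          cst ((1 - a * b * c * d * q ^ (m%:Z - 1))
               / (a * b * (1 - c * d * q ^+ m.-1))) * Pplus m
          + cst (s ^+ m.-1) * w
              * cst ((a * b - 1) / (a * b * (1 - c * d * q ^+ m.-1)))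
              * Qplus m.-1 ].
Proof.
move=> a b c d x P Pplus Pminus Qplus w.
have hq (j : nat) : (0 < j)%N -> q ^+ j != 1.
  move=> j0; apply: contraNneq hq1 => /(congr1 Num.norm).
  by rewrite normrX normr1 => /eqP; rewrite pexpr_eq1 ?normr_ge0.
have hs0 : s != 0 := sqrt_neq0 hq0 hs.
have abE : a * b = - k1 ^+ 2.
  by rewrite /a /b /AWa /AWb mulrN mulrACA divff // mulr1 expr2.
have cdE : c * d = - (q * k0 ^+ 2).
  rewrite /c /d /AWc /AWd -hs mulrN mulrACA divff // mulr1.
  by congr (- _); ring.
have abcdE : a * b * c * d = k0 ^+ 2 * k1 ^+ 2 * q.
  by rewrite -mulrA cdE abE; ring.
have wE : w = wt (cst s) (cst k0) (cst u0) x.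
  rewrite /w /c /d /AWc /AWd /wt rmorphN !rmorphM fmorphV /=.
  by rewrite mulNr opprK.
have [D0 G0] : (forall m, 1 + k0 ^+ 2 * q ^+ m != 0) /\
    (forall m, (0 < m)%N -> 1 - k0 ^+ 2 * k1 ^+ 2 * q ^+ m != 0).
  split=> m; last by move/ggamma; rewrite subr_eq0 eq_sym.
  rewrite addrC; apply: contraTneq isT => /eqP; rewrite addr_eq0 => /eqP e.
  (* Vanishing would mean k0^2 = -q^(-m). *)
  have [_ /eqP[]] := gk0 (- m%:Z).
  rewrite -exprnN -[k0 ^+ 2](mulfK (x := q ^+ m)) ?expf_neq0 //.
  by rewrite e mulN1r.
(* Part (ii) in substance: P_(-m) is solved for, and [H] is identified with the rescaled shifted
   polynomial. *)
have base l : let H := reflect_diff q s k0 k1 u0 u1 l in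
   P (- l.+1%:Z) = cst (1 + k0 ^+ 2 * q ^+ l.+1)^-1 * (Pplus l.+1 - w * H)
   /\ cst (s ^+ l) * Qplus l = H.
  move=> H; split.
    have e := nonsymAWN_decomposition hq0 hs hk0 hk1 hu0 hu1 hq ggamma l.
    by rewrite wE -e mul_cst mulVf // rmorph1 mul1r.
  have e := symAW_shift hq0 hs hk0 hk1 hu0 hu1 hq ggamma l.
  by rewrite /Qplus e mul_cst divff ?expf_neq0 // rmorph1 mul1r.
have comm l z : cst (s ^+ l) * w * cst z * Qplus l
    = cst z * (w * (cst (s ^+ l) * Qplus l)).
  by move: (w) (Qplus l) (cst (s ^+ l)) (cst z) => f g h y; ring.
(* Both (i) and (iii) have the shape P^+ - h (P^+ - w H) with a constant h. *)
have lin (f g h : {fraction {poly (complex R)}}) :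
    f - h * (f - g) = (1 - h) * f + h * g by ring.
have cdq l : 1 - c * d * q ^+ l = 1 + k0 ^+ 2 * q ^+ l.+1.
  by rewrite cdE (exprS q); ring.
have abcdq l : a * b * c * d * q ^ (l.+1%:Z - 1) = k0 ^+ 2 * k1 ^+ 2 * q ^+ l.+1.
  by rewrite abcdE (_ : l.+1%:Z - 1 = l%:Z) -?exprnP ?(exprS q); [ring|lia].
have abcdq2 l : a * b * c * d * q ^ (2 * l.+1%:Z - 1)
    = k0 ^+ 2 * k1 ^+ 2 * (q ^+ l.+1) ^+ 2.
  rewrite abcdE (_ : 2 * l.+1%:Z - 1 = (l.*2.+1)%:Z); last by lia.
  rewrite -exprnP -exprM muln2 doubleS [q ^+ l.*2.+2]exprS; ring.
split=> [[|l]|[//|l] _|[//|l] _].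
(* For m = 0 the quotient has equal numerator and denominator, nonzero by [nz], and both polynomials
   are 1. *)
- rewrite mulr0 sub0r => nz.
  rewrite expr0 mul1r divff // rmorph1 mul1r addr0.
  rewrite /P /Pplus nonsymAW0 // symAW0 //.
- move=> _; rewrite /= comm; have [N1 ->] := base l.
  rewrite abcdq abcdq2 /P nonsymAW_sym // -symAW_E // -/(P _) N1 /sym_coef gamma_nat.
  have Gl : 1 - k0 ^+ 2 * k1 ^+ 2 * (q ^+ l.+1) ^+ 2 != 0 by rewrite -exprM; apply: G0.
  have Ql : q ^+ l.+1 != 0 by rewrite expf_neq0.
  rewrite nonsym_coefE // nonsym_coefE' // mul_cst mulfK //.
  rewrite rmorphN mulNr rmorphB rmorph1.
  exact: lin.
- rewrite /= comm; have [-> ->] := base l; rewrite cdq div1r.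
  by rewrite mulrBr.
rewrite /= comm; have [N1 ->] := base l.
rewrite /Pminus antisymAW_E // -symAW_E // -/(P _) N1.
rewrite abcdq cdq abE -antisym_coefE // -antisym_coefE' //.
rewrite mul_cst rmorphB rmorph1.
exact: lin.
Qed.
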